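(* A non-empty closed set $C\subseteq 2^\omega$ is a random closed set if and only if $C$ is the $1/3$-support of some random measure $\mu\in\mathscr{P}(2^\omega)$.
   Context: $\lambda$ denotes the uniform measure on $2^\omega$, $\lambda_3$ the uniform measure on $3^\omega$; Martin-Löf randomness of $x\in n^\omega$ is with respect to the uniform measure $\lambda_n$: $x$ is Martin-Löf random if $x\notin\bigcap_iU_i$ for every uniformly $\Sigma^0_1$ sequence $(U_i)$ of open sets with $\lambda_n(U_i)\le2^{-i}$. Random measures: fix a computable bijection $\langle\cdot,\cdot\rangle:\omega^2\to\omega$. For $x\in2^\omega$ let its $n$-th column be $x_n\in2^\omega$, $x_n(k)=x(\langle n,k\rangle)$, identified with the real number $\sum_k x_n(k)2^{-(k+1)}\in[0,1]$. Let $\sigma_0=\epsilon,\sigma_1=0,\sigma_2=1,\dots$ be the length-lexicographic enumeration of $2^{<\omega}$. Then $\mu_x$ is the unique Borel probability measure on $2^\omega$ with $\mu_x(\llbracket\sigma_n0\rrbracket)=x_n\cdot\mu_x(\llbracket\sigma_n\rrbracket)$ for all $n$. A measure $\mu$ is a random measure if $\mu=\mu_x$ for some Martin-Löf random $x\in2^\omega$. For a measure $\mu$ and strings $\rho\preceq\tau$, $\mu(\tau\mid\rho)=\mu(\llbracket\tau\rrbracket)/\mu(\llbracket\rho\rrbracket)$. Define $T_\mu=\{\sigma\in2^{<\omega}:(\forall i<|\sigma|)\ \mu(\sigma\restriction(i+1)\mid\sigma\restriction i)>1/3\}\cup\{\epsilon\}$; the $1/3$-support of $\mu$ is the closed set $[T_\mu]$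 of infinite paths through $T_\mu$. Random closed sets: for $x\in 3^\omega$ the tree $T_x$ is defined by $\epsilon\in T_x$ and, if $\sigma$ is the $(i+1)$-st node of $T_x$ (length-lexicographic order), $\sigma0\in T_x,\sigma1\notin T_x$ if $x(i)=0$; $\sigma0\notin T_x,\sigma1\in T_x$ if $x(i)=1$; both if $x(i)=2$. $C$ is a random closed set if $C=[T_x]$ for some Martin-Löf random $x\in3^\omega$. *)

(* Defs.v *)
From Stdlib Require Import Reals List Arith ClassicalDescription.
From Coquelicot Require Import Coquelicot.
Import ListNotations.
Open Scope nat_scope.

(* A concrete model of computability: primitive recursive functions    *)
(* (untyped syntax; missing arguments default to 0).                   *)
Inductive prf : Type :=
| PZero : prf
| PSucc : prf
| PProj : nat -> prf
| PComp : prf -> list prf -> prf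
| PRec  : prf -> prf -> prf.

Fixpoint prf_eval (f : prf) (args : list nat) {struct f} : nat :=
  match f with
  | PZero => 0
  | PSucc => S (hd 0 args)
  | PProj i => nth i args 0
  | PComp h gs => prf_eval h (map (fun g => prf_eval g args) gs)
  | PRec b s =>
      let fix go (n : nat) : nat :=
        match n with
        | O => prf_eval b (tl args)
        | S m => prf_eval s (m :: go m :: tl args)
        end in
      go (hd 0 args)
  end.

(* Finite strings over the alphabet {0,...,n-1} (as list nat), coded   *)
(* by naturals via bijective base-n numeration (computable).           *)
Fixpoint decode_fuel (n fuel m : nat) : list nat :=
  match fuel with
  | O => []
  | S f => match m with
           | O => []
           | S m' => (m' mod n)%nat :: decode_fuel n f (m' / n)%nat
           end
  end.
Definition decode_str (n m : nat) : list nat := decode_fuel n m m.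

Definition prefix {A} (x : nat -> A) (N : nat) : list A := map x (seq 0 N).

Fixpoint all_strings (n N : nat) : list (list nat) :=
  match N with
  | O => [[]]
  | S N' => flat_map (fun s => map (fun d => s ++ [d]) (seq 0 n)) (all_strings n N')
  end.

Definition in_open (S : list nat -> Prop) (x : nat -> nat) : Prop :=
  exists s, S s /\ prefix x (length s) = s.

Definition has_prefix_in (S : list nat -> Prop) (t : list nat) : bool :=
  if excluded_middle_informative (exists s, S s /\ firstn (length s) t = s /\
                                    (length s <= length t)%nat)
  then true else false.

Open Scope R_scope.

(* uniform measure lambda_n of the open set [[S]] :
   lambda_n([[S]]) = lim_N  #{t in n^N : t extends some s in S} / n^N
   (the sequence is nondecreasing and bounded by 1). *)
Definition lambda_open (n : nat) (S : list nat -> Prop) : R :=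
  real (Lim_seq (fun N =>
     INR (length (filter (has_prefix_in S) (all_strings n N))) / INR (n ^ N))).

(* the i-th open set of the uniformly Sigma^0_1 sequence coded by the
   primitive recursive function R: strings enumerated as (code-1) where
   code = R(i,k) > 0, k ranging over nat. Every uniformly Sigma^0_1
   sequence of open sets arises this way. *)
Definition test_set (n : nat) (Rf : prf) (i : nat) : list nat -> Prop :=
  fun s => exists k m, prf_eval Rf [i; k] = S m /\ decode_str n m = s.

Definition ML_random (n : nat) (x : nat -> nat) : Prop :=
  (forall i, (x i < n)%nat) /\
  forall Rf : prf,
    (forall i, lambda_open n (test_set n Rf i) <= (/ 2) ^ i) ->
    ~ (forall i, in_open (test_set n Rf i) x).

Definition bits (x : nat -> bool) : nat -> nat := fun i => if x i then 1%nat else 0%nat.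

Definition pairing (n k : nat) : nat := ((n + k) * (n + k + 1) / 2 + k)%nat.

Definition column_real (x : nat -> bool) (n : nat) : R :=
  Series (fun k => if x (pairing n k) then (/ 2) ^ (S k) else 0).

(* length-lexicographic enumeration sigma_0 = eps, sigma_1 = 0, sigma_2 = 1, ... *)
Fixpoint sigma_fuel (fuel n : nat) : list bool :=
  match fuel with
  | O => []
  | S f => match n with
           | O => []
           | S m => sigma_fuel f (m / 2)%nat ++ [Nat.odd m]
           end
  end.
Definition sigma_str (n : nat) : list bool := sigma_fuel n n.

(* A Borel probability measure on 2^omega, represented (Caratheodory) by
   its values on basic cylinders [[s]]. *)
Definition cyl_prob (mu : list bool -> R) : Prop :=
  mu [] = 1 /\
  forall s, 0 <= mu s /\ mu s = mu (s ++ [false]) + mu (s ++ [true]).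

Definition is_mu_of (x : nat -> bool) (mu : list bool -> R) : Prop :=
  cyl_prob mu /\
  forall n, mu (sigma_str n ++ [false]) = column_real x n * mu (sigma_str n).

Definition random_measure (mu : list bool -> R) : Prop :=
  exists x : nat -> bool, ML_random 2 (bits x) /\ is_mu_of x mu.

Definition cond_prob (mu : list bool -> R) (t r : list bool) : R := mu t / mu r.

Definition T_mu (mu : list bool -> R) (s : list bool) : Prop :=
  forall i, (i < length s)%nat ->
    cond_prob mu (firstn (S i) s) (firstn i s) > 1 / 3.

Definition third_support (mu : list bool -> R) (y : nat -> bool) : Prop :=
  forall N, T_mu mu (prefix y N).

(* Random closed sets.  x in 3^omega is x : nat -> nat with values < 3. *)
(* The tree T_x is built level by level: level L lists the nodes of    *)
(* length L in lexicographic order, together with the length-lex index *)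
(* of its first node; node number j (0-based, length-lex) gets the     *)
(* label x(j).                                                         *)
Definition children (d : nat) (s : list bool) : list (list bool) :=
  match d with
  | O => [s ++ [false]]
  | 1%nat => [s ++ [true]]
  | _ => [s ++ [false]; s ++ [true]]
  end.

Fixpoint kids (x : nat -> nat) (i : nat) (ns : list (list bool)) : list (list bool) :=
  match ns with
  | [] => []
  | s :: r => children (x i) s ++ kids x (S i) r
  end.

(* (index of first node of length L, nodes of T_x of length L in lex order) *)
Fixpoint T_level (x : nat -> nat) (L : nat) : nat * list (list bool) :=
  match L with
  | O => (0%nat, [[]])
  | S L' => let (st, ns) := T_level x L' in ((st + length ns)%nat, kids x st ns)
  end.

Definition T3 (x : nat -> nat) (s : list bool) : Prop := In s (snd (T_level x (length s))).

Definition paths_T3 (x : nat -> nat) (y : nat -> bool) : Prop := forall N, T3 x (prefix y N).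

Definition random_closed_set (C : (nat -> bool) -> Prop) : Prop :=
  exists x : nat -> nat, ML_random 3 x /\ forall y, C y <-> paths_T3 x y.

Definition cantor_closed (C : (nat -> bool) -> Prop) : Prop :=
  forall y, (forall N, exists z, C z /\ prefix z N = prefix y N) -> C y.

(* Main.v *)
(* Let column [n] of a random [x : 2^omega] choose the label of node [n] according
   to the third of [0, 1] containing its real.  Reading these labels in order
   along the tree that they generate couples the uniform measures on [2^omega] and
   [3^omega], with integer-valued computable density [density].  The theorem rests
   on a symmetric principle ([coupling_random]): for a computable coupling, every
   random point has a random partner compatible with it at all finite stages.
   Given [z] random, the conditional measures of the stages of a test form a
   submartingale along [z], bounded by Ville's inequality; so each test can be
   replaced by one of its open sets of as small conditional measure as desired.
   There are countably many tests, so these open sets do not cover the fibre over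
   [z], and compactness yields a partner outside all of them: no universal test
   is needed.  Finally, columns of a random [x] differ from 1/3 and 2/3, so
   compatibility forces the two trees to coincide. *)

Require Import Defs.
From Stdlib Require Import Reals Arith Lia Lra Cantor.
From Stdlib Require Import Classical ClassicalEpsilon ClassicalDescription FunctionalExtensionality.
From Coquelicot Require Import Coquelicot.
From Stdlib Require Import List.
Import ListNotations.
Local Open Scope bool_scope.
Local Open Scope nat_scope.
Set Bullet Behavior "Strict Subproofs".

(** * Primitive recursive functions *)

(** The obstacle is that tree and measure do not determine each other. A label fixes only the third
    that contains a column, columns of nodes outside the tree leave no trace in the labels, and
    which column the i-th label describes depends on the earlier labels. A random sequence on either
    side therefore has to be completed by a random one on the other. A coupling treats both
    completions alike, because it uses only the mass of pairs of cylinders and the uniformity of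
    both marginals.

    All computable quantities are natural numbers. A column known to l digits lies in an interval of
    length 2^-l. The overlap of this interval with a third, measured in units of 2^-l / 3, is
    exactly the factor by which the label of that node changes the density. Measures become counts
    of words of a given length, and inequalities between them are multiplied out by powers of the
    alphabet sizes, so that no rational arithmetic has to be shown primitive recursive. *)

Definition PR (k : nat) (f : list nat -> nat) : Prop :=
  exists p, forall l, length l = k -> prf_eval p l = f l.

Lemma PR_ext k f g : (forall l, f l = g l) -> PR k f -> PR k g.
Proof. intros H [p Hp]; exists p; intros l Hl; rewrite <- H; auto. Qed.

Lemma PR_nth k i : PR k (fun l => nth i l 0).
Proof. exists (PProj i); reflexivity. Qed.

Lemma hd_iter_tl i (l : list nat) : hd 0 (Nat.iter i (@tl nat) l) = nth i l 0.
Proof.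
  revert l; induction i as [|i IH]; intros [|x l]; simpl; auto.
  - rewrite <- Nat.iter_succ, Nat.iter_succ_r; simpl; rewrite IH; destruct i; auto.
  - rewrite <- Nat.iter_succ, Nat.iter_succ_r; simpl; auto.
Qed.

(** The combinators below present the i-th argument as [hd 0 (tl (... l))]. For a numeral [i] the
    iterate is convertible to that form, so [pr_var] closes the goal by [exact]. *)
Lemma PR_var i k : PR k (fun l => hd 0 (Nat.iter i (@tl nat) l)).
Proof.
  apply PR_ext with (fun l => nth i l 0); [|apply PR_nth].
  intros; now rewrite hd_iter_tl.
Qed.

Lemma PR_S k f : PR k f -> PR k (fun l => S (f l)).
Proof.
  intros [p Hp]; exists (PComp PSucc [p]); intros l Hl; simpl; now rewrite Hp.
Qed.

Lemma PR_const k c : PR k (fun _ => c).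
Proof.
  induction c as [|c IH]; [exists PZero; reflexivity|now apply PR_S in IH].
Qed.

Lemma map_nth_seq (l : list nat) : map (fun i => nth i l 0) (seq 0 (length l)) = l.
Proof.
  induction l as [|x l IH]; simpl; auto.
  f_equal; rewrite <- seq_shift, map_map; exact IH.
Qed.

(** [PRec] consumes the recursion argument, so the program puts [n l] in front and passes all of [l]
    again by projections. This is why [PR] fixes the length of its lists. *)
Lemma PR_rec k (F : list nat -> nat -> nat) b s n :
  (forall l, F l 0 = b l) -> (forall l m, F l (S m) = s m (F l m) l) ->
  PR k b -> PR (S (S k)) (fun l => s (hd 0 l) (hd 0 (tl l)) (tl (tl l))) -> PR k n ->
  PR k (fun l => F l (n l)).
Proof.
  intros H0 HS [pb Hb] [ps Hs] [pn Hn].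
  exists (PComp (PRec pb ps) (pn :: map PProj (seq 0 k))); intros l Hl.
  assert (E : map (fun g => prf_eval g l) (map PProj (seq 0 k)) = l).
  { rewrite map_map; simpl; rewrite <- Hl; apply map_nth_seq. }
  simpl; rewrite E, Hn by auto.
  induction (n l) as [|m IH].
  - rewrite Hb, H0; auto.
  - rewrite Hs by (simpl; lia); simpl; rewrite IH, HS; auto.
Qed.

Lemma PR_comp1 k (f : nat -> nat) g :
  PR 1 (fun l => f (hd 0 l)) -> PR k g -> PR k (fun l => f (g l)).
Proof.
  intros [p Hp] [q Hq]; exists (PComp p [q]); intros l Hl; simpl.
  rewrite Hp by reflexivity; simpl; now rewrite Hq.
Qed.

Lemma PR_comp2 k (f : nat -> nat -> nat) g h :
  PR 2 (fun l => f (hd 0 l) (hd 0 (tl l))) -> PR k g -> PR k h ->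
  PR k (fun l => f (g l) (h l)).
Proof.
  intros [p Hp] [q Hq] [r Hr]; exists (PComp p [q; r]); intros l Hl; simpl.
  rewrite Hp by reflexivity; simpl; now rewrite Hq, Hr.
Qed.

Lemma PR_comp3 k (f : nat -> nat -> nat -> nat) g h i :
  PR 3 (fun l => f (hd 0 l) (hd 0 (tl l)) (hd 0 (tl (tl l)))) ->
  PR k g -> PR k h -> PR k i -> PR k (fun l => f (g l) (h l) (i l)).
Proof.
  intros [p Hp] [q Hq] [r Hr] [s Hs]; exists (PComp p [q; r; s]); intros l Hl; simpl.
  rewrite Hp by reflexivity; simpl; now rewrite Hq, Hr, Hs.
Qed.

Lemma PR_prf_eval2 k p f g :
  PR k f -> PR k g -> PR k (fun l => prf_eval p [f l; g l]).
Proof.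
  intros [q Hq] [r Hr]; exists (PComp p [q; r]); intros l Hl; simpl.
  now rewrite Hq, Hr.
Qed.

Ltac pr_var := first
  [ exact (PR_var 0 _) | exact (PR_var 1 _) | exact (PR_var 2 _) | exact (PR_var 3 _)
  | exact (PR_var 4 _) | exact (PR_var 5 _) | exact (PR_var 6 _) | exact (PR_var 7 _) ].

Lemma PR_add k f g : PR k f -> PR k g -> PR k (fun l => f l + g l).
Proof.
  apply (PR_comp2 k Nat.add).
  apply (PR_rec 2 (fun l n => n + hd 0 (tl l)) (fun l => hd 0 (tl l)) (fun _ r _ => S r) (hd 0));
    auto; try apply PR_S; pr_var.
Qed.

Lemma PR_mul k f g : PR k f -> PR k g -> PR k (fun l => f l * g l).
Proof.
  apply (PR_comp2 k Nat.mul).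
  apply (PR_rec 2 (fun l n => n * hd 0 (tl l)) (fun l => 0) (fun _ r l => hd 0 (tl l) + r) (hd 0));
    auto; try apply PR_add; try apply PR_const; pr_var.
Qed.

Lemma PR_pow k f g : PR k f -> PR k g -> PR k (fun l => f l ^ g l).
Proof.
  apply (PR_comp2 k Nat.pow).
  apply (PR_rec 2 (fun l n => hd 0 l ^ n) (fun l => 1) (fun _ r l => hd 0 l * r) (fun l => hd 0 (tl l)));
    auto; try apply PR_mul; try apply PR_const; pr_var.
Qed.

Lemma PR_pred k f : PR k f -> PR k (fun l => Nat.pred (f l)).
Proof.
  apply (PR_comp1 k Nat.pred).
  apply (PR_rec 1 (fun l n => Nat.pred n) (fun l => 0) (fun m r l => m) (fun l => hd 0 l));
    auto; try apply PR_const; pr_var.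
Qed.

Lemma PR_sub k f g : PR k f -> PR k g -> PR k (fun l => f l - g l).
Proof.
  apply (PR_comp2 k Nat.sub).
  apply (PR_rec 2 (fun l n => hd 0 l - n) (fun l => hd 0 l) (fun _ r l => Nat.pred r) (fun l => hd 0 (tl l)));
    [intros; apply Nat.sub_0_r|intros; lia|pr_var|apply PR_pred; pr_var|pr_var].
Qed.

Definition PRb (k : nat) (b : list nat -> bool) : Prop := PR k (fun l => Nat.b2n (b l)).

Lemma PR_if k b f g :
  PRb k b -> PR k f -> PR k g -> PR k (fun l => if b l then f l else g l).
Proof.
  intros Hb Hf Hg.
  apply PR_ext with (fun l => Nat.b2n (b l) * f l + (1 - Nat.b2n (b l)) * g l).
  { intros l; destruct (b l); simpl; lia. }
  apply PR_add; apply PR_mul; try apply PR_sub; auto; apply PR_const.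
Qed.

Lemma PRb_leb k f g : PR k f -> PR k g -> PRb k (fun l => f l <=? g l).
Proof.
  intros Hf Hg; apply PR_ext with (fun l => 1 - (f l - g l)).
  { intros l; destruct (Nat.leb_spec (f l) (g l)); cbn [Nat.b2n]; lia. }
  apply PR_sub; [apply PR_const|now apply PR_sub].
Qed.

Lemma PRb_ltb k f g : PR k f -> PR k g -> PRb k (fun l => f l <? g l).
Proof. intros Hf Hg; apply PRb_leb; auto; now apply PR_S. Qed.

Lemma PRb_andb k b c : PRb k b -> PRb k c -> PRb k (fun l => b l && c l)%bool.
Proof.
  intros Hb Hc; apply PR_ext with (fun l => Nat.b2n (b l) * Nat.b2n (c l)).
  { intros l; now destruct (b l), (c l). }
  now apply PR_mul.
Qed.

Lemma PRb_negb k b : PRb k b -> PRb k (fun l => negb (b l)).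
Proof.
  intros Hb; apply PR_ext with (fun l => 1 - Nat.b2n (b l)).
  { intros l; now destruct (b l). }
  apply PR_sub; auto; apply PR_const.
Qed.

Lemma PRb_eqb k f g : PR k f -> PR k g -> PRb k (fun l => f l =? g l).
Proof.
  intros Hf Hg; apply PR_ext with (fun l => Nat.b2n ((f l <=? g l) && (g l <=? f l))).
  { intros l; destruct (Nat.leb_spec (f l) (g l)), (Nat.leb_spec (g l) (f l)),
      (Nat.eqb_spec (f l) (g l)); simpl; lia. }
  apply PRb_andb; now apply PRb_leb.
Qed.

Lemma PRb_if k b c d :
  PRb k b -> PRb k c -> PRb k d -> PRb k (fun l => if b l then c l else d l).
Proof.
  intros Hb Hc Hd; apply PR_ext with (fun l => if b l then Nat.b2n (c l) else Nat.b2n (d l)).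
  { intros l; now destruct (b l). }
  now apply PR_if.
Qed.

Fixpoint bsum (n : nat) (f : nat -> nat) : nat :=
  match n with O => 0 | S m => bsum m f + f m end.

Fixpoint bprod (n : nat) (f : nat -> nat) : nat :=
  match n with O => 1 | S m => bprod m f * f m end.

Lemma PR_bsum k n (f : nat -> list nat -> nat) :
  PR k n -> PR (S k) (fun l => f (hd 0 l) (tl l)) ->
  PR k (fun l => bsum (n l) (fun m => f m l)).
Proof.
  intros Hn [p Hp].
  apply (PR_rec k (fun l n => bsum n (fun m => f m l)) (fun _ => 0) (fun m r l => r + f m l));
    auto; [apply PR_const|].
  apply PR_add; [pr_var|].
  (* The recursion step receives the index, the accumulator and [l]; the program of the summand must
     skip the accumulator, at position 1. *)
  exists (PComp p (PProj 0 :: map PProj (seq 2 k))); intros l Hl.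
  destruct l as [|x [|y l]]; try discriminate; simpl.
  assert (E : map (fun g => prf_eval g (x :: y :: l)) (map PProj (seq 2 k)) = l).
  { rewrite map_map, <- seq_shift, <- seq_shift, !map_map; simpl in *.
    replace k with (length l) by lia; apply map_nth_seq. }
  rewrite E, Hp by (simpl in *; lia); reflexivity.
Qed.

Lemma PR_bprod k n (f : nat -> list nat -> nat) :
  PR k n -> PR (S k) (fun l => f (hd 0 l) (tl l)) ->
  PR k (fun l => bprod (n l) (fun m => f m l)).
Proof.
  intros Hn [p Hp].
  apply (PR_rec k (fun l n => bprod n (fun m => f m l)) (fun _ => 1) (fun m r l => r * f m l));
    auto; [apply PR_const|].
  apply PR_mul; [pr_var|].
  exists (PComp p (PProj 0 :: map PProj (seq 2 k))); intros l Hl.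
  destruct l as [|x [|y l]]; try discriminate; simpl.
  assert (E : map (fun g => prf_eval g (x :: y :: l)) (map PProj (seq 2 k)) = l).
  { rewrite map_map, <- seq_shift, <- seq_shift, !map_map; simpl in *.
    replace k with (length l) by lia; apply map_nth_seq. }
  rewrite E, Hp by (simpl in *; lia); reflexivity.
Qed.

Lemma PRb_existsb k n (b : nat -> list nat -> bool) :
  PR k n -> PRb (S k) (fun l => b (hd 0 l) (tl l)) ->
  PRb k (fun l => existsb (fun m => b m l) (seq 0 (n l))).
Proof.
  intros Hn Hb.
  apply PR_ext with (fun l => Nat.b2n (0 <? bsum (n l) (fun m => Nat.b2n (b m l)))).
  { intros l; f_equal; induction (n l) as [|m IH]; [reflexivity|].
    rewrite seq_S, existsb_app, <- IH; simpl.
    destruct (b m l); simpl; [|rewrite Nat.add_0_r; now destruct (0 <? _)].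
    rewrite Bool.orb_true_r; apply Nat.ltb_lt; lia. }
  apply PRb_ltb; [apply PR_const|].
  now apply (PR_bsum k n (fun m l => Nat.b2n (b m l))).
Qed.

Lemma PRb_forallb k n (b : nat -> list nat -> bool) :
  PR k n -> PRb (S k) (fun l => b (hd 0 l) (tl l)) ->
  PRb k (fun l => forallb (fun m => b m l) (seq 0 (n l))).
Proof.
  intros Hn Hb.
  apply PR_ext with (fun l => Nat.b2n (negb (existsb (fun m => negb (b m l)) (seq 0 (n l))))).
  { intros l; f_equal; induction (seq 0 (n l)) as [|m s IH]; simpl; auto.
    rewrite <- IH, Bool.negb_orb, Bool.negb_involutive; reflexivity. }
  apply PRb_negb, (PRb_existsb k n (fun m l => negb (b m l))); auto.
  now apply PRb_negb.
Qed.

(** A positive divisor [g l] gives as quotient the number of m below [f l] with (m + 1) [g l] at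
    most [f l]; [Nat.div] by 0 is 0. *)
Lemma PR_div k f g : PR k f -> PR k g -> PR k (fun l => f l / g l).
Proof.
  intros Hf Hg.
  apply PR_ext with (fun l => if g l =? 0 then 0
                              else bsum (f l) (fun m => Nat.b2n (S m * g l <=? f l))).
  { intros l; destruct (Nat.eqb_spec (g l) 0) as [E|E]; [now rewrite E|].
    assert (H : forall n, bsum n (fun m => Nat.b2n (S m * g l <=? f l)) = Nat.min n (f l / g l)).
    { induction n as [|n IH]; [reflexivity|]; cbn [bsum]; rewrite IH.
      pose proof (Nat.div_mod_eq (f l) (g l)); pose proof (Nat.mod_upper_bound (f l) (g l) E).
      destruct (Nat.leb_spec (S n * g l) (f l)); cbn [Nat.b2n].
      - assert (S n <= f l / g l) by (apply Nat.div_le_lower_bound; lia); lia.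
      - assert (f l / g l < S n) by (apply Nat.Div0.div_lt_upper_bound; lia); lia. }
    rewrite H; apply Nat.min_r, Nat.Div0.div_le_upper_bound; nia. }
  apply PR_if; [apply PRb_eqb; auto; apply PR_const|apply PR_const|].
  apply (PR_comp2 k (fun a b => bsum a (fun m => Nat.b2n (S m * b <=? a)))); auto.
  apply (PR_bsum 2 (hd 0) (fun m l => Nat.b2n (S m * hd 0 (tl l) <=? hd 0 l))); [pr_var|].
  apply PRb_leb; [apply PR_mul; [apply PR_S|]|]; pr_var.
Qed.

Lemma PR_mod k f g : PR k f -> PR k g -> PR k (fun l => f l mod g l).
Proof.
  intros Hf Hg; apply PR_ext with (fun l => f l - g l * (f l / g l)).
  { intros l; pose proof (Nat.div_mod_eq (f l) (g l)); lia. }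
  apply PR_sub; auto; apply PR_mul; auto; now apply PR_div.
Qed.

Lemma PRb_odd k f : PR k f -> PRb k (fun l => Nat.odd (f l)).
Proof.
  intros Hf; apply PR_ext with (fun l => f l mod 2).
  { intros l; now rewrite <- Nat.bit0_mod, Nat.bit0_odd. }
  apply PR_mod; auto; apply PR_const.
Qed.

Lemma PR_min k f g : PR k f -> PR k g -> PR k (fun l => Nat.min (f l) (g l)).
Proof.
  intros Hf Hg; apply PR_ext with (fun l => f l - (f l - g l)); [intros; lia|].
  apply PR_sub; auto; now apply PR_sub.
Qed.

Lemma PR_max k f g : PR k f -> PR k g -> PR k (fun l => Nat.max (f l) (g l)).
Proof.
  intros Hf Hg; apply PR_ext with (fun l => f l + (g l - f l)); [intros; lia|].
  apply PR_add; auto; now apply PR_sub.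
Qed.

(** * Primitive recursive access to coded strings *)

Lemma decode_fuel_enough n fuel m :
  m <= fuel -> decode_fuel n fuel m = decode_str n m.
Proof.
  unfold decode_str; revert m.
  assert (H : forall f g m, m <= f -> m <= g -> decode_fuel n f m = decode_fuel n g m).
  { induction f as [|f IH]; intros [|g] [|m] Hf Hg; simpl; auto; try lia.
    assert (m / n <= m) by (destruct n; [simpl; lia|apply Nat.Div0.div_le_upper_bound; nia]).
    f_equal; apply IH; lia. }
  intros m Hm; now apply H.
Qed.

Lemma decode_str_S n m : decode_str n (S m) = m mod n :: decode_str n (m / n).
Proof.
  unfold decode_str at 1; simpl; f_equal; apply decode_fuel_enough.
  destruct n; [simpl; lia|apply Nat.Div0.div_le_upper_bound; nia].
Qed.

(** The code of the string without its first [i] letters. Code 0, the empty string, is mapped to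
    itself because [pred 0 / n] is 0. *)
Fixpoint drop_code (n c i : nat) : nat :=
  match i with O => c | S j => Nat.pred (drop_code n c j) / n end.

Lemma decode_drop_code n c i : decode_str n (drop_code n c i) = skipn i (decode_str n c).
Proof.
  induction i as [|i IH]; [reflexivity|]; cbn [drop_code].
  assert (E : decode_str n (Nat.pred (drop_code n c i) / n) = tl (decode_str n (drop_code n c i))).
  { destruct (drop_code n c i) as [|m]; [|now rewrite decode_str_S].
    now replace (Nat.pred 0 / n) with 0 by now destruct n. }
  rewrite E, IH; clear.
  revert i; induction (decode_str n c) as [|x l IHl]; intros [|i]; simpl; auto.
Qed.

Lemma PR_drop_code n k c i : PR k c -> PR k i -> PR k (fun l => drop_code n (c l) (i l)).
Proof.
  apply (PR_comp2 k (drop_code n)).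
  apply (PR_rec 2 (fun l i => drop_code n (hd 0 l) i) (fun l => hd 0 l)
           (fun _ r _ => Nat.pred r / n) (fun l => hd 0 (tl l)));
    [reflexivity|reflexivity|pr_var| |pr_var].
  apply PR_div; [apply PR_pred; pr_var|apply PR_const].
Qed.

Lemma drop_code_0 n c i : (drop_code n c i =? 0) = (length (decode_str n c) <=? i).
Proof.
  pose proof (f_equal (@length nat) (decode_drop_code n c i)) as H.
  rewrite length_skipn in H; revert H.
  destruct (drop_code n c i) as [|m]; [|rewrite decode_str_S]; simpl; intros H;
    destruct (Nat.leb_spec (length (decode_str n c)) i); auto; lia.
Qed.

Lemma length_decode_le n c : length (decode_str n c) <= c.
Proof.
  induction c as [c IH] using lt_wf_ind; destruct c as [|m]; [simpl; lia|].
  rewrite decode_str_S; simpl.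
  assert (m / n <= m) by (destruct n; [simpl; lia|apply Nat.Div0.div_le_upper_bound; nia]).
  specialize (IH (m / n)); lia.
Qed.

(** The length is the number of i for which dropping i letters leaves something; the code itself
    bounds the search. *)
Lemma PR_length_decode n k c : PR k c -> PR k (fun l => length (decode_str n (c l))).
Proof.
  apply (PR_comp1 k (fun c => length (decode_str n c))).
  apply PR_ext with (fun l => bsum (hd 0 l) (fun i => Nat.b2n (negb (drop_code n (hd 0 l) i =? 0)))).
  { intros l; set (c' := hd 0 l).
    assert (H : forall m, bsum m (fun i => Nat.b2n (negb (drop_code n c' i =? 0)))
                          = Nat.min m (length (decode_str n c'))).
    { induction m as [|m IH]; [reflexivity|]; cbn [bsum]; rewrite IH, drop_code_0.
      destruct (Nat.leb_spec (length (decode_str n c')) m); cbn [Nat.b2n negb]; lia. }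
    rewrite H; apply Nat.min_r, length_decode_le. }
  apply (PR_bsum 1 (hd 0) (fun i l => Nat.b2n (negb (drop_code n (hd 0 l) i =? 0)))); [pr_var|].
  apply PRb_negb, PRb_eqb; [apply PR_drop_code; pr_var|apply PR_const].
Qed.

Lemma PR_nth_decode n k c i :
  PR k c -> PR k i -> PR k (fun l => nth (i l) (decode_str n (c l)) 0).
Proof.
  intros Hc Hi.
  apply PR_ext with (fun l => if drop_code n (c l) (i l) =? 0 then 0
                              else Nat.pred (drop_code n (c l) (i l)) mod n).
  { intros l; pose proof (decode_drop_code n (c l) (i l)) as H.
    pose proof (nth_skipn (i l) (decode_str n (c l)) 0 0) as H'; rewrite Nat.add_0_r in H'.
    rewrite <- H', <- H.
    destruct (drop_code n (c l) (i l)) as [|m]; [reflexivity|now rewrite decode_str_S]. }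
  apply PR_if; [apply PRb_eqb| |apply PR_mod; [apply PR_pred|]]; try apply PR_const;
    now apply PR_drop_code.
Qed.

Ltac pr1 := first
  [ apply PR_const | pr_var | assumption
  | lazymatch goal with
    | |- PR _ (fun l => S _) => apply PR_S
    | |- PR _ (fun l => Nat.add _ _) => apply PR_add
    | |- PR _ (fun l => Nat.mul _ _) => apply PR_mul
    | |- PR _ (fun l => Nat.pow _ _) => apply PR_pow
    | |- PR _ (fun l => Nat.sub _ _) => apply PR_sub
    | |- PR _ (fun l => Nat.pred _) => apply PR_pred
    | |- PR _ (fun l => Nat.div _ _) => apply PR_div
    | |- PR _ (fun l => Nat.modulo _ _) => apply PR_mod
    | |- PR _ (fun l => Nat.min _ _) => apply PR_min
    | |- PR _ (fun l => Nat.max _ _) => apply PR_max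
    | |- PR ?k (fun l => Nat.b2n (@?b l)) => change (PRb k b)
    | |- PRb _ (fun l => true) => apply (PR_const _ 1)
    | |- PRb _ (fun l => false) => apply (PR_const _ 0)
    | |- PR _ (fun l => if _ then _ else _) => apply PR_if
    | |- PR _ (fun l => bsum (@?n l) (fun m => @?f m l)) =>
        apply (PR_bsum _ n (fun m l => f m l))
    | |- PR _ (fun l => bprod (@?n l) (fun m => @?f m l)) =>
        apply (PR_bprod _ n (fun m l => f m l))
    | |- PR _ (fun l => prf_eval _ [_; _]) => apply PR_prf_eval2
    | |- PR _ (fun l => length (decode_str _ _)) => apply PR_length_decode
    | |- PR _ (fun l => nth _ (decode_str _ _) 0) => apply PR_nth_decode
    | |- PRb _ (fun l => Nat.leb _ _) => apply PRb_leb
    | |- PRb _ (fun l => Nat.ltb _ _) => apply PRb_ltb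
    | |- PRb _ (fun l => Nat.eqb _ _) => apply PRb_eqb
    | |- PRb _ (fun l => andb _ _) => apply PRb_andb
    | |- PRb _ (fun l => negb _) => apply PRb_negb
    | |- PRb _ (fun l => Nat.odd _) => apply PRb_odd
    | |- PRb _ (fun l => if _ then _ else _) => apply PRb_if
    | |- PRb _ (fun l => existsb (fun m => @?f m l) (seq 0 (@?n l))) =>
        apply (PRb_existsb _ n (fun m l => f m l))
    | |- PRb _ (fun l => forallb (fun m => @?f m l) (seq 0 (@?n l))) =>
        apply (PRb_forallb _ n (fun m l => f m l))
    end ].
Ltac pr := cbv beta; repeat (pr1; cbv beta).

(** * Measures of open sets and Ville's inequality *)

Lemma bsum_le n f g : (forall i, i < n -> f i <= g i) -> bsum n f <= bsum n g.
Proof.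
  induction n as [|n IH]; intros H; simpl; [lia|].
  pose proof (H n); assert (bsum n f <= bsum n g) by auto; lia.
Qed.

Lemma bsum_ext n f g : (forall i, i < n -> f i = g i) -> bsum n f = bsum n g.
Proof. induction n as [|n IH]; intros H; simpl; [|rewrite IH, H]; auto. Qed.

Lemma bsum_mul_l n c f : bsum n (fun i => c * f i) = c * bsum n f.
Proof. induction n as [|n IH]; simpl; [lia|]; rewrite IH; lia. Qed.

Lemma bsum_plus n f g : bsum n (fun i => f i + g i) = bsum n f + bsum n g.
Proof. induction n as [|n IH]; simpl; [lia|]; rewrite IH; lia. Qed.

Lemma bsum_const n c : bsum n (fun _ => c) = n * c.
Proof. induction n as [|n IH]; simpl; [lia|]; rewrite IH; lia. Qed.

Lemma bsum_swap n m f :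
  bsum n (fun i => bsum m (fun j => f i j)) = bsum m (fun j => bsum n (fun i => f i j)).
Proof.
  induction n as [|n IH]; simpl; [now rewrite bsum_const, Nat.mul_0_r|].
  now rewrite IH, bsum_plus.
Qed.

Lemma bsum_app n m f : bsum (n + m) f = bsum n f + bsum m (fun i => f (n + i)).
Proof.
  induction m as [|m IH]; [rewrite Nat.add_0_r; simpl; lia|].
  rewrite Nat.add_succ_r; simpl; rewrite IH; lia.
Qed.

Lemma bsum_shift n f : bsum (S n) f = f 0 + bsum n (fun i => f (S i)).
Proof. apply (bsum_app 1 n). Qed.

Lemma bsum_term n f i : i < n -> f i <= bsum n f.
Proof.
  induction n as [|n IH]; intros H; simpl; [lia|].
  destruct (Nat.eq_dec i n) as [->|E]; [lia|]; assert (f i <= bsum n f) by (apply IH; lia); lia.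
Qed.

Lemma bsum_geom n c f : (forall j, j < n -> 2 ^ S j * f j <= c) -> bsum n f <= c.
Proof.
  (* The induction needs the exact partial sum c (1 - 2^-n) of the geometric series, here multiplied
     by 2^n. *)
  intros H; assert (E : 2 ^ n * bsum n f + c <= 2 ^ n * c);
    [|pose proof (Nat.pow_nonzero 2 n); nia].
  induction n as [|n IH]; simpl bsum; [simpl; lia|].
  assert (2 ^ n * bsum n f + c <= 2 ^ n * c) by auto.
  specialize (H n (Nat.lt_succ_diag_r n)); rewrite Nat.pow_succ_r' in *; nia.
Qed.

(** * Sums over all words of a given length *)

Notation word a := (List.Forall (fun d => d < a)).

(** Divided by [a ^ N] this is the integral of [f] over the uniform measure, with [f] read as a step
    function on cylinders of length [N]. *)
Fixpoint strsum (a N : nat) (f : list nat -> nat) : nat :=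
  match N with
  | O => f []
  | S N' => bsum a (fun d => strsum a N' (fun s => f (d :: s)))
  end.

Lemma strsum_le a N f g :
  (forall s, word a s -> length s = N -> f s <= g s) -> strsum a N f <= strsum a N g.
Proof.
  revert f g; induction N as [|N IH]; intros f g H; simpl; [now apply H|].
  apply bsum_le; intros d Hd; apply IH; intros s Hs HN; apply H; simpl; auto.
Qed.

Lemma strsum_ext a N f g :
  (forall s, word a s -> length s = N -> f s = g s) -> strsum a N f = strsum a N g.
Proof.
  intros H; apply Nat.le_antisymm; apply strsum_le; intros s Hs HN; rewrite H; auto.
Qed.

Lemma strsum_mul_l a N c f : strsum a N (fun s => c * f s) = c * strsum a N f.
Proof.
  revert f; induction N as [|N IH]; intros f; simpl; auto.
  rewrite <- bsum_mul_l; apply bsum_ext; intros d _; apply IH.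
Qed.

Lemma strsum_bsum a N n f :
  strsum a N (fun s => bsum n (fun j => f j s)) = bsum n (fun j => strsum a N (f j)).
Proof.
  revert f; induction N as [|N IH]; intros f; simpl; auto.
  rewrite <- bsum_swap; apply bsum_ext; intros d _; apply (IH (fun j s => f j (d :: s))).
Qed.

Lemma strsum_const a N c : strsum a N (fun _ => c) = a ^ N * c.
Proof.
  induction N as [|N IH]; simpl; [lia|]; rewrite IH, bsum_const; lia.
Qed.

Lemma strsum_snoc a N f :
  strsum a (S N) f = strsum a N (fun s => bsum a (fun d => f (s ++ [d]))).
Proof.
  revert f; induction N as [|N IH]; intros f; [reflexivity|].
  change (strsum a (S (S N)) f) with (bsum a (fun d => strsum a (S N) (fun s => f (d :: s)))).
  simpl; apply bsum_ext; intros d _; apply (IH (fun s => f (d :: s))).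
Qed.

Lemma strsum_swap a N b M f :
  strsum a N (fun s => strsum b M (fun t => f s t))
  = strsum b M (fun t => strsum a N (fun s => f s t)).
Proof.
  revert f; induction M as [|M IH]; intros f; simpl; auto.
  rewrite strsum_bsum; apply bsum_ext; intros d _; apply (IH (fun s t => f s (d :: t))).
Qed.

Lemma list_sum_seq n f : list_sum (map f (seq 0 n)) = bsum n f.
Proof.
  induction n as [|n IH]; [reflexivity|].
  rewrite seq_S, map_app, list_sum_app, IH; simpl; lia.
Qed.

Lemma strsum_all_strings a N f : list_sum (map f (all_strings a N)) = strsum a N f.
Proof.
  revert f; induction N as [|N IH]; intros f; [simpl; lia|].
  rewrite strsum_snoc, <- IH; simpl; clear IH.
  induction (all_strings a N) as [|s l IHl]; simpl; auto.
  rewrite map_app, list_sum_app, IHl, map_map; f_equal; apply list_sum_seq.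
Qed.

Lemma decode_cons a d c : d < a -> decode_str a (S (d + a * c)) = d :: decode_str a c.
Proof.
  intros Hd; rewrite decode_str_S; f_equal; [|f_equal].
  - rewrite Nat.mul_comm, Nat.Div0.mod_add; now apply Nat.mod_small.
  - rewrite Nat.mul_comm, Nat.div_add by lia; now rewrite Nat.div_small.
Qed.

Lemma decode_word a c : 0 < a -> word a (decode_str a c).
Proof.
  intros Ha; induction c as [c IH] using lt_wf_ind; destruct c as [|m]; [constructor|].
  rewrite decode_str_S; constructor; [apply Nat.mod_upper_bound; lia|].
  apply IH, Nat.lt_succ_r, Nat.Div0.div_le_upper_bound; nia.
Qed.

Lemma decode_surj a s : word a s -> exists c, decode_str a c = s.
Proof.
  induction 1 as [|d s Hd Hs [c Hc]]; [now exists 0|].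
  exists (S (d + a * c)); now rewrite decode_cons, Hc.
Qed.

Fixpoint code_bound (a N : nat) : nat :=
  match N with O => 1 | S N' => S (a * code_bound a N') end.

Lemma bsum_mul_range a n f :
  bsum (a * n) f = bsum n (fun c => bsum a (fun d => f (d + a * c))).
Proof.
  induction n as [|n IH]; [now rewrite Nat.mul_0_r|].
  rewrite Nat.mul_succ_r, bsum_app, IH; simpl; f_equal.
  apply bsum_ext; intros; f_equal; lia.
Qed.

(** The recursion of [strsum] changes its summand at each letter and so is not a primitive recursion
    on numbers; the sum over codes is one. *)
Lemma strsum_codes a N f :
  bsum (code_bound a N) (fun c => if length (decode_str a c) =? N then f (decode_str a c) else 0)
  = strsum a N f.
Proof.
  revert f; induction N as [|N IH]; intros f; [reflexivity|].
  cbn [code_bound]; rewrite bsum_shift, bsum_mul_range, bsum_swap.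
  change (decode_str a 0) with (@nil nat); cbn -[decode_str].
  apply bsum_ext; intros d Hd; rewrite <- IH; apply bsum_ext; intros c _.
  rewrite decode_cons by assumption; reflexivity.
Qed.

Lemma PR_code_bound a k n : PR k n -> PR k (fun l => code_bound a (n l)).
Proof.
  apply (PR_rec k (fun _ n => code_bound a n) (fun _ => 1) (fun _ r _ => S (a * r))); auto; pr.
Qed.

Lemma PR_strsum a k n (f : list nat -> list nat -> nat) :
  PR k n -> PR (S k) (fun l => n (tl l)) ->
  PR (S k) (fun l => f (decode_str a (hd 0 l)) (tl l)) ->
  PR k (fun l => strsum a (n l) (fun t => f t l)).
Proof.
  intros Hn Hn' Hf.
  apply PR_ext with (fun l => bsum (code_bound a (n l)) (fun c =>
    if length (decode_str a c) =? n l then f (decode_str a c) l else 0)).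
  { intros l; apply (strsum_codes a (n l) (fun t => f t l)). }
  apply (PR_bsum k (fun l => code_bound a (n l)) (fun c l =>
    if length (decode_str a c) =? n l then f (decode_str a c) l else 0));
    [now apply PR_code_bound|pr].
Qed.

Lemma length_filter_strsum a N p :
  length (filter p (all_strings a N)) = strsum a N (fun t => Nat.b2n (p t)).
Proof.
  rewrite <- strsum_all_strings; induction (all_strings a N) as [|s l IH]; simpl; auto.
  destruct (p s); simpl; lia.
Qed.

(** * The uniform measure in terms of finite counts *)

Lemma has_prefix_in_spec S t :
  has_prefix_in S t = true <-> exists s, S s /\ firstn (length s) t = s /\ length s <= length t.
Proof.
  unfold has_prefix_in; destruct (excluded_middle_informative _); split; auto; discriminate.
Qed.

Lemma pow_pos_INR b N : 0 < b -> (0 < INR (b ^ N))%R.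
Proof. intros Hb; apply lt_0_INR; pose proof (Nat.pow_nonzero b N); lia. Qed.

Lemma pow_half i : ((/ 2) ^ i = / INR (2 ^ i))%R.
Proof. rewrite pow_INR, pow_inv; reflexivity. Qed.

Lemma lambda_open_le b S i : 0 < b ->
  (forall N, 2 ^ i * strsum b N (fun t => Nat.b2n (has_prefix_in S t)) <= b ^ N) ->
  (lambda_open b S <= (/ 2) ^ i)%R.
Proof.
  intros Hb H; unfold lambda_open.
  set (u := fun N => _).
  assert (Hu : Rbar_le (Lim_seq u) (Finite ((/ 2) ^ i))).
  { rewrite <- (Lim_seq_const ((/ 2) ^ i)); apply Lim_seq_le_loc; exists 0; intros N _; unfold u.
    rewrite length_filter_strsum, pow_half.
    specialize (H N); apply le_INR in H; rewrite mult_INR in H.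
    pose proof (pow_pos_INR b N Hb); pose proof (pow_pos_INR 2 i ltac:(lia)).
    apply Rle_div_l; [assumption|].
    apply (Rmult_le_reg_l (INR (2 ^ i))); [assumption|].
    rewrite <- Rmult_assoc, Rinv_r, Rmult_1_l; lra. }
  destruct (Lim_seq u); simpl in *; try easy.
  (* What remains is the limit [m_infty], which [real] turns into 0. *)
  apply pow_le; lra.
Qed.

(** The proportion of words of length N meeting [S] increases with N and is at most 1, so the limit
    is finite and dominates every stage. *)
Lemma lambda_open_ge b S i N : 0 < b -> (lambda_open b S <= (/ 2) ^ i)%R ->
  2 ^ i * strsum b N (fun t => Nat.b2n (has_prefix_in S t)) <= b ^ N.
Proof.
  intros Hb; unfold lambda_open; set (u := fun N => _).
  assert (Hinc : forall n, (u n <= u (Datatypes.S n))%R).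
  { intros n; unfold u; rewrite !length_filter_strsum, strsum_snoc.
    pose proof (pow_pos_INR b n Hb); pose proof (lt_0_INR b Hb).
    assert (Hle : b * strsum b n (fun t => Nat.b2n (has_prefix_in S t)) <=
             strsum b n (fun s => bsum b (fun d => Nat.b2n (has_prefix_in S (s ++ [d]))))).
    { rewrite <- strsum_mul_l; apply strsum_le; intros s _ _.
      rewrite <- bsum_const; apply bsum_le; intros d _.
      destruct (has_prefix_in S s) eqn:E; [|simpl; lia].
      replace (has_prefix_in S (s ++ [d])) with true; [lia|].
      symmetry; apply has_prefix_in_spec; apply has_prefix_in_spec in E as (r & H1 & H2 & H3).
      exists r; repeat split; auto; [|rewrite length_app; lia].
      rewrite firstn_app, H2; replace (length r - length s) with 0 by lia; apply app_nil_r. }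
    apply le_INR in Hle; rewrite mult_INR in Hle; rewrite Nat.pow_succ_r', mult_INR.
    apply (Rle_div_r _ _ (INR b * INR (b ^ n))); [now apply Rmult_lt_0_compat|]; eapply Rle_trans; [|exact Hle]; right; field; lra. }
  assert (Hbd : forall n, (u n <= 1)%R).
  { intros n; unfold u; rewrite length_filter_strsum; pose proof (pow_pos_INR b n Hb).
    apply Rle_div_l; [assumption|]; rewrite Rmult_1_l; apply le_INR.
    rewrite <- (Nat.mul_1_r (b ^ n)), <- strsum_const; apply strsum_le; intros.
    destruct (has_prefix_in _ _); simpl; lia. }
  destruct (ex_finite_lim_seq_incr u 1 Hinc Hbd) as [l Hl].
  intros H; rewrite (is_lim_seq_unique u l Hl) in H; simpl in H.
  pose proof (is_lim_seq_incr_compare u l Hl Hinc N) as HN.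
  unfold u in HN; rewrite length_filter_strsum in HN; rewrite pow_half in H.
  pose proof (pow_pos_INR b N Hb); pose proof (pow_pos_INR 2 i ltac:(lia)).
  apply INR_le; rewrite mult_INR.
  apply (Rmult_le_reg_l (/ INR (2 ^ i))); [now apply Rinv_0_lt_compat|].
  rewrite <- Rmult_assoc, Rinv_l, Rmult_1_l by lra.
  apply Rle_div_l in HN; [|assumption].
  eapply Rle_trans; [exact HN|]; apply Rmult_le_compat_r; lra.
Qed.

(** * Prefixes, decidable tests and submartingales *)

Lemma length_prefix {A} (z : nat -> A) m : length (prefix z m) = m.
Proof. unfold prefix; now rewrite length_map, length_seq. Qed.

Lemma prefix_S {A} (z : nat -> A) m : prefix z (S m) = prefix z m ++ [z m].
Proof. unfold prefix; now rewrite seq_S, map_app. Qed.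

Lemma firstn_prefix {A} (z : nat -> A) n m : n <= m -> firstn n (prefix z m) = prefix z n.
Proof.
  intros H; induction H as [|m H IH]; [rewrite <- (length_prefix z n) at 1; apply firstn_all|].
  rewrite prefix_S, firstn_app, IH, length_prefix; replace (n - m) with 0 by lia; apply app_nil_r.
Qed.

Lemma nth_prefix {A} (z : nat -> A) n i d : i < n -> nth i (prefix z n) d = z i.
Proof.
  intros H; unfold prefix; rewrite (nth_indep _ d (z 0)) by now rewrite length_map, length_seq.
  rewrite map_nth, seq_nth; auto.
Qed.

Lemma word_prefix a z m : (forall i, z i < a) -> word a (prefix z m).
Proof. intros H; apply List.Forall_forall; intros d Hd; apply in_map_iff in Hd as (i & <- & _); auto. Qed.

(* [D] holds of some extension of [w] that is a prefix of [w ++ v]. *)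
Fixpoint hits (D : list nat -> bool) (w v : list nat) : bool :=
  D w || match v with [] => false | d :: v' => hits D (w ++ [d]) v' end.

Lemma hits_intro D w v s :
  D (w ++ s) = true -> firstn (length s) v = s -> hits D w v = true.
Proof.
  revert w v; induction s as [|d s IH]; intros w v HD Hf; simpl in *.
  - rewrite app_nil_r in HD; destruct v; simpl; now rewrite HD.
  - destruct v as [|d' v]; [discriminate|]; injection Hf as -> Hf; simpl.
    rewrite (IH (w ++ [d]) v), Bool.orb_true_r; auto; now rewrite <- app_assoc.
Qed.

(** A decidable family is enumerated without search: step k outputs the code k itself if [D i]
    accepts it, and nothing otherwise. The bound concerns [hits], since an accepted word puts all
    its extensions into the open set. *)
Lemma ML_random_avoids b z (D : nat -> list nat -> bool) :
  0 < b -> ML_random b z ->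
  PRb 2 (fun l => D (hd 0 l) (decode_str b (hd 0 (tl l)))) ->
  (forall i N, 2 ^ i * strsum b N (fun v => Nat.b2n (hits (D i) [] v)) <= b ^ N) ->
  exists i, forall m, D i (prefix z m) = false.
Proof.
  intros Hb [Hz HR] HD Hm.
  assert (HP : PR 2 (fun l => if D (hd 0 l) (decode_str b (hd 0 (tl l)))
                              then S (hd 0 (tl l)) else 0)).
  { apply PR_if; [exact HD|pr|pr]. }
  destruct HP as [p Hp].
  assert (HT : forall i s, test_set b p i s <-> word b s /\ D i s = true).
  { intros i s; split.
    - intros (k & m & E & <-); rewrite Hp in E by reflexivity; simpl in E.
      destruct (D i (decode_str b k)) eqn:Ed; [injection E as <-|discriminate].
      split; auto; now apply decode_word.
    - intros [Hs Hd]; destruct (decode_surj b s Hs) as [c Hc].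
      exists c, c; rewrite Hp by reflexivity; simpl; now rewrite Hc, Hd. }
  assert (Hlam : forall i, (lambda_open b (test_set b p i) <= (/ 2) ^ i)%R).
  { intros i; apply lambda_open_le; auto; intros N; rewrite <- Hm.
    apply Nat.mul_le_mono_l, strsum_le; intros t _ _.
    destruct (has_prefix_in _ t) eqn:E; [|simpl; lia].
    apply has_prefix_in_spec in E as (s & Hs & Hf & _); apply HT in Hs as [_ Hs].
    rewrite (hits_intro (D i) [] t s); auto. }
  specialize (HR p Hlam); apply not_all_ex_not in HR as [i Hi]; exists i; intros m.
  destruct (D i (prefix z m)) eqn:E; auto; exfalso; apply Hi.
  exists (prefix z m); rewrite length_prefix; split; auto.
  apply HT; split; auto; now apply word_prefix.
Qed.

(* Ville's inequality for the submartingale [w |-> G w / a ^ length w]. *)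
Lemma ville a b c (G : list nat -> nat) (D : list nat -> bool) :
  (forall w, word b w -> a * b * G w <= bsum b (fun d => G (w ++ [d]))) ->
  (forall w, D w = true -> c * a ^ length w <= G w) ->
  forall n w, word b w ->
  c * a ^ (length w + n) * strsum b n (fun v => Nat.b2n (hits D w v))
  <= strsum b n (fun v => G (w ++ v)).
Proof.
  intros HG HD.
  assert (grow : forall n w, word b w -> (a * b) ^ n * G w <= strsum b n (fun v => G (w ++ v))).
  { induction n as [|n IH]; intros w Hw; simpl; [rewrite app_nil_r; lia|].
    apply Nat.le_trans with (bsum b (fun d => (a * b) ^ n * G (w ++ [d]))).
    - rewrite bsum_mul_l; specialize (HG w Hw); nia.
    - apply bsum_le; intros d Hd; eapply Nat.le_trans; [apply IH, List.Forall_app; auto|].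
      apply strsum_le; intros s _ _; now rewrite <- app_assoc. }
  (* If [D w] holds, every extension is counted and [grow] gives the bound. Otherwise both sides
     split over the next letter. *)
  induction n as [|n IH]; intros w Hw; destruct (D w) eqn:Ed.
  - specialize (HD w Ed); simpl; rewrite Ed, app_nil_r, Nat.add_0_r; simpl; lia.
  - simpl; rewrite Ed; simpl; lia.
  - specialize (grow (S n) w Hw); eapply Nat.le_trans; [|exact grow].
    rewrite (strsum_ext b (S n) _ (fun _ => 1)).
    + rewrite strsum_const, Nat.pow_add_r, Nat.pow_mul_l; specialize (HD w Ed).
      replace (c * (a ^ length w * a ^ S n) * (b ^ S n * 1))
        with (a ^ S n * b ^ S n * (c * a ^ length w)) by ring.
      now apply Nat.mul_le_mono_l.
    + intros [|d v] _ _; simpl; now rewrite Ed.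
  - simpl; rewrite <- bsum_mul_l; apply bsum_le; intros d Hd.
    rewrite (strsum_ext b n (fun v => G (w ++ d :: v)) (fun v => G ((w ++ [d]) ++ v)))
      by (intros; now rewrite <- app_assoc).
    eapply Nat.le_trans; [|apply IH, List.Forall_app; auto].
    rewrite length_app; simpl; rewrite Ed, <- Nat.add_assoc; reflexivity.
Qed.

(** The expectations of [G w / a ^ length w] stay at most 1, so by Ville's inequality it exceeds 2^i
    somewhere with probability at most 2^-i. These events form a test, and [z] escapes one of its
    members. *)
Lemma ML_random_submartingale a b z (G : list nat -> nat) :
  0 < b -> 0 < a -> ML_random b z ->
  PR 1 (fun l => G (decode_str b (hd 0 l))) ->
  (forall w, word b w -> a * b * G w <= bsum b (fun d => G (w ++ [d]))) ->
  (forall L, strsum b L G <= (a * b) ^ L) ->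
  exists i, forall m, G (prefix z m) <= 2 ^ i * a ^ m.
Proof.
  intros Hb Ha Hz HP HG HS.
  destruct (ML_random_avoids b z (fun i w => 2 ^ i * a ^ length w <? G w)) as [i Hi]; auto.
  - pr; apply (PR_comp1 2 (fun k => G (decode_str b k))); [exact HP|pr].
  - intros i N.
    pose proof (ville a b (2 ^ i) G (fun w => 2 ^ i * a ^ length w <? G w) HG) as HV.
    specialize (HV (fun w H => Nat.lt_le_incl _ _ (proj1 (Nat.ltb_lt _ _) H)) N [] (List.Forall_nil _)).
    simpl in HV; specialize (HS N); rewrite Nat.pow_mul_l in HS.
    pose proof (Nat.pow_nonzero a N); apply (Nat.mul_le_mono_pos_l _ _ (a ^ N)); [lia|].
    eapply Nat.le_trans; [|exact HS]; eapply Nat.le_trans; [|exact HV].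
    apply Nat.eq_le_incl; ring.
  - exists i; intros m; specialize (Hi m); apply Nat.ltb_ge in Hi; now rewrite length_prefix in Hi.
Qed.

(** * Avoiding countably many small open sets in a fibre *)

Fixpoint nat_list_of_nat (fuel n : nat) : list nat :=
  match fuel, n with
  | S f, S m => let (h, t) := Cantor.of_nat m in h :: nat_list_of_nat f t
  | _, _ => []
  end.

Lemma nat_list_of_nat_surj l : exists n, forall f, n <= f -> nat_list_of_nat f n = l.
Proof.
  induction l as [|h l [n Hn]]; [exists 0; intros [|f] _; reflexivity|].
  exists (S (Cantor.to_nat (h, n))); intros [|f] Hf; [lia|].
  cbn [nat_list_of_nat]; rewrite Cantor.cancel_of_to; f_equal; apply Hn.
  pose proof (Cantor.to_nat_non_decreasing h n); lia.
Qed.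

Fixpoint prf_of_nat (fuel n : nat) : prf :=
  match fuel with
  | O => PZero
  | S f =>
      let (tag, r) := Cantor.of_nat n in
      let (u, v) := Cantor.of_nat r in
      match tag with
      | 0 => PZero
      | 1 => PSucc
      | 2 => PProj r
      | 3 => PComp (prf_of_nat f u) (map (prf_of_nat f) (nat_list_of_nat v v))
      | _ => PRec (prf_of_nat f u) (prf_of_nat f v)
      end
  end.

(** A direct fixpoint, because the induction principle of [prf] gives no hypothesis for the list
    inside [PComp]. Every fuel from [f0] on must work, so that subterms can share one fuel. *)
Fixpoint prf_of_nat_surj (p : prf) :
  exists n f0, forall f, f0 <= f -> prf_of_nat f n = p.
Proof.
  destruct p as [| |i|h gs|p q].
  - exists (Cantor.to_nat (0, 0)), 0; intros [|f] _; reflexivity.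
  - exists (Cantor.to_nat (1, 0)), 1; intros [|f] Hf; [lia|reflexivity].
  - exists (Cantor.to_nat (2, i)), 1; intros [|f] Hf; [lia|]; cbn [prf_of_nat].
    rewrite Cantor.cancel_of_to; now destruct (Cantor.of_nat i).
  - destruct (prf_of_nat_surj h) as (nh & fh & Hh).
    assert (Hgs : exists ns f0, forall f, f0 <= f -> map (prf_of_nat f) ns = gs).
    { induction gs as [|g gs (ns & f0 & IH)]; [now exists [], 0|].
      destruct (prf_of_nat_surj g) as (ng & fg & Hg).
      exists (ng :: ns), (fg + f0); intros f Hf; simpl; rewrite Hg, IH; auto; lia. }
    destruct Hgs as (ns & f0 & Hgs); destruct (nat_list_of_nat_surj ns) as [v Hv].
    exists (Cantor.to_nat (3, Cantor.to_nat (nh, v))), (S (fh + f0)); intros [|f] Hf; [lia|].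
    cbn [prf_of_nat]; rewrite !Cantor.cancel_of_to, Hv, Hh, Hgs; auto; lia.
  - destruct (prf_of_nat_surj p) as (np & fp & Hp), (prf_of_nat_surj q) as (nq & fq & Hq).
    exists (Cantor.to_nat (4, Cantor.to_nat (np, nq))), (S (fp + fq)); intros [|f] Hf; [lia|].
    cbn [prf_of_nat]; rewrite !Cantor.cancel_of_to, Hp, Hq; auto; lia.
Qed.

Lemma prf_countable : exists E : nat -> prf, forall p, exists n, E n = p.
Proof.
  exists (fun n => let (f, m) := Cantor.of_nat n in prf_of_nat f m); intros p.
  destruct (prf_of_nat_surj p) as (n & f & H); exists (Cantor.to_nat (f, n)).
  rewrite Cantor.cancel_of_to; auto.
Qed.

(** Finitely many thresholds have a common bound. In [koenig] this shows that a word extended at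
    infinitely many levels has a one-letter extension with the same property. *)
Lemma eventually_bounded_choice a (Q : nat -> nat -> Prop) :
  (forall d, d < a -> exists K, forall k, K <= k -> ~ Q d k) ->
  exists K, forall d k, d < a -> K <= k -> ~ Q d k.
Proof.
  induction a as [|a IH]; intros H; [exists 0; lia|].
  destruct IH as [K1 H1]; [auto|]; destruct (H a) as [K2 H2]; [lia|].
  exists (K1 + K2); intros d k Hd Hk; destruct (Nat.eq_dec d a) as [->|E].
  - apply H2; lia.
  - apply H1; lia.
Qed.

(** Here [Q] is not assumed closed under prefixes, so prefixes of [y] need not satisfy it; instead
    each of them extends to words satisfying [Q] at arbitrarily high levels. *)
Lemma koenig a (Q : nat -> list nat -> Prop) :
  (forall K, exists t, length t = K /\ word a t /\ Q K t) ->
  exists y, (forall i, y i < a) /\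
    forall N K0, exists K t, K0 <= K /\ N <= K /\ length t = K /\ word a t /\ Q K t /\ firstn N t = prefix y N.
Proof.
  intros HQ.
  set (ext := fun s K => exists t, length t = K /\ word a t /\ Q K t /\
                length s <= K /\ firstn (length s) t = s).
  set (Inf := fun s => forall K0, exists K, K0 <= K /\ ext s K).
  assert (step : forall s, Inf s -> exists d, d < a /\ Inf (s ++ [d])).
  { intros s Hs; apply NNPP; intros Hn.
    destruct (eventually_bounded_choice a (fun d K => ext (s ++ [d]) K)) as [K0 HK0].
    { intros d Hd; apply NNPP; intros Hc; apply Hn; exists d; split; auto; intros K0.
      apply NNPP; intros Hc'; apply Hc; exists K0; intros k Hk He; apply Hc'; eauto. }
    destruct (Hs (K0 + S (length s))) as (K & HK & t & Ht & Ha & HQt & Hle & Hf).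
    assert (Hlt : length s < length t) by lia.
    apply (HK0 (nth (length s) t 0) K); [|lia|].
    - apply (proj1 (List.Forall_forall _ _) Ha), nth_In, Hlt.
    - exists t; rewrite length_app; simpl; repeat split; auto; [lia|].
      rewrite <- Hf at 2; rewrite Nat.add_1_r; clear - Hlt.
      revert t Hlt; induction (length s) as [|n IH]; intros [|x t] H; simpl in *; try lia; auto.
      f_equal; apply IH; lia. }
  set (next := fun s => epsilon (inhabits 0) (fun d => d < a /\ Inf (s ++ [d]))).
  set (str := fix str n := match n with O => [] | S m => str m ++ [next (str m)] end).
  assert (Hstr : forall n, Inf (str n)).
  { induction n as [|n IH].
    - intros K0; destruct (HQ K0) as (t & H1 & H2 & H3); exists K0; split; auto; exists t; simpl.
      repeat split; auto; lia.
    - apply (epsilon_spec (inhabits 0) (fun d => d < a /\ Inf (str n ++ [d])) (step _ IH)). }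
  assert (Hpre : forall n, str n = prefix (fun i => next (str i)) n).
  { induction n as [|n IH]; [reflexivity|]; rewrite prefix_S, <- IH; reflexivity. }
  exists (fun i => next (str i)); split.
  - intros i; apply (epsilon_spec (inhabits 0) (fun d => d < a /\ Inf (str i ++ [d])) (step _ (Hstr i))).
  - intros N K0; destruct (Hstr N K0) as (K & HK & t & H1 & H2 & H3 & H4 & H5).
    rewrite Hpre, length_prefix in *; exists K, t; repeat split; auto.
Qed.

(* [P s w / (a ^ length s * b ^ length w)] is the mass that a coupling of the
   uniform measures on [a^omega] and [b^omega] gives to the product of the
   cylinders [s] and [w]. *)
Record coupling (a b : nat) (P : list nat -> list nat -> nat) : Prop := {
  coupling_nil_l : forall w, word b w -> P [] w = 1;
  coupling_nil_r : forall s, word a s -> P s [] = 1;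
  coupling_snoc_l : forall s w, word a s -> word b w ->
    bsum a (fun d => P (s ++ [d]) w) = a * P s w;
  coupling_snoc_r : forall s w, word a s -> word b w ->
    bsum b (fun d => P s (w ++ [d])) = b * P s w
}.

Lemma coupling_total_l a b P N w :
  coupling a b P -> word b w -> strsum a N (fun t => P t w) = a ^ N.
Proof.
  intros HP Hw; induction N as [|N IH]; [now apply (coupling_nil_l _ _ _ HP)|].
  rewrite strsum_snoc, (strsum_ext _ _ _ (fun s => a * P s w)).
  - rewrite strsum_mul_l, IH; reflexivity.
  - intros s Hs _; now apply (coupling_snoc_l _ _ _ HP).
Qed.

Lemma coupling_sym a b P : coupling a b P -> coupling b a (fun s w => P w s).
Proof. intros []; split; auto. Qed.

Lemma coupling_pos_r a b P s w v :
  coupling a b P -> word a s -> word b (w ++ v) -> 0 < P s (w ++ v) -> 0 < P s w.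
Proof.
  intros HP Hs; induction v as [|d v IH] using rev_ind; [now rewrite app_nil_r|].
  rewrite app_assoc; intros Hw H; apply List.Forall_app in Hw as [Hw Hd].
  apply IH; auto; pose proof (coupling_snoc_r _ _ _ HP s (w ++ v) Hs Hw) as E.
  pose proof (bsum_term b (fun d => P s ((w ++ v) ++ [d])) d (List.Forall_inv Hd)) as Ht.
  cbv beta in Ht; rewrite E in Ht; nia.
Qed.

Lemma coupling_pos_prefix a b P t w y N z M m :
  coupling a b P -> word a t -> (forall i, z i < b) -> M <= m ->
  firstn N t = prefix y N -> w = prefix z m ->
  0 < P t w -> 0 < P (prefix y N) (prefix z M).
Proof.
  intros HP Ht Hz HM <- -> H.
  assert (HtN : word a (firstn N t)).
  { rewrite <- (firstn_skipn N t) in Ht; now apply List.Forall_app in Ht. }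
  pose proof (word_prefix b z m Hz) as Hm.
  rewrite <- (firstn_prefix z M m HM).
  apply (coupling_pos_r a b P _ _ (skipn M (prefix z m))); rewrite ?firstn_skipn; auto.
  apply (coupling_pos_r b a (fun s w => P w s) _ _ (skipn N t)); rewrite ?firstn_skipn; auto.
  now apply coupling_sym.
Qed.

(* Countably many open sets [A e], the [e]-th of conditional measure at most
   [2 ^ -(e+2)] given [z], cannot cover the fibre over [z]. *)
Lemma coupling_avoid a b P z (A : nat -> nat -> list nat -> bool) :
  0 < a -> coupling a b P -> (forall i, z i < b) ->
  (forall e N t d, A e N t = true -> A e (S N) (t ++ [d]) = true) ->
  (forall e, exists m0, forall m, m0 <= m ->
     2 ^ (e + 2) * strsum a m (fun t => Nat.b2n (A e m t) * P t (prefix z m)) <= a ^ m) ->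
  exists y, (forall i, y i < a) /\ (forall N M, 0 < P (prefix y N) (prefix z M)) /\
    forall e N, e < N -> A e N (prefix y N) = false.
Proof.
  intros Ha HP Hz Hmono Hsmall.
  (* Level N looks only at the sets with e below N, so that only finitely many thresholds [m0] have
     to be passed. *)
  set (bad := fun N t => existsb (fun e => A e N t) (seq 0 N)).
  (* Smallness is known only from some level m on. For fixed [w], conditional mass is preserved when
     words are extended and [A e] only grows, so the bound transfers down to level N. *)
  assert (Hstage : forall e N m, N <= m ->
    a ^ (m - N) * strsum a N (fun t => Nat.b2n (A e N t) * P t (prefix z m))
    <= strsum a m (fun t => Nat.b2n (A e m t) * P t (prefix z m))).
  { intros e N m Hle; set (w := prefix z m).
    assert (Hw : word b w) by now apply word_prefix.
    clearbody w; induction Hle as [|m Hle IH].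
    - rewrite Nat.sub_diag, Nat.pow_0_r; lia.
    - rewrite Nat.sub_succ_l, Nat.pow_succ_r', <- Nat.mul_assoc by lia.
      eapply Nat.le_trans; [apply Nat.mul_le_mono_l, IH|].
      rewrite strsum_snoc, <- strsum_mul_l; apply strsum_le; intros t Ht _.
      replace (a * (Nat.b2n (A e m t) * P t w)) with (Nat.b2n (A e m t) * (a * P t w)) by ring.
      rewrite <- (coupling_snoc_l _ _ _ HP), <- bsum_mul_l by assumption.
      apply bsum_le; intros d _; apply Nat.mul_le_mono_r.
      destruct (A e m t) eqn:E; [rewrite Hmono|simpl]; auto; lia. }
  assert (Hex : forall N, exists t, length t = N /\ word a t /\ bad N t = false /\
                  exists m, N <= m /\ 0 < P t (prefix z m)).
  { intros N.
    assert (Hm0 : forall K, exists m, N <= m /\ forall e, e < K ->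
      2 ^ (e + 2) * strsum a m (fun t => Nat.b2n (A e m t) * P t (prefix z m)) <= a ^ m).
    { assert (H : forall K, exists m0, N <= m0 /\ forall m, m0 <= m -> forall e, e < K ->
        2 ^ (e + 2) * strsum a m (fun t => Nat.b2n (A e m t) * P t (prefix z m)) <= a ^ m).
      { induction K as [|K (m1 & H1 & IH)]; [exists N; split; auto; lia|].
        destruct (Hsmall K) as [m2 H2]; exists (m1 + m2); split; [lia|].
        intros m Hm e He; destruct (Nat.eq_dec e K) as [->|E].
        - apply H2; lia.
        - apply IH; lia. }
      intros K; destruct (H K) as (m0 & H1 & H2); exists m0; split; auto. }
    destruct (Hm0 N) as (m & Hm & Hb); clear Hm0.
    set (w := prefix z m) in *; assert (Hw : word b w) by now apply word_prefix.
    (* The bounds 2^-(e+2) sum to at most 1/2, while the total conditional mass is 1. Hence some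
       word of positive mass is not bad. *)
    assert (Hsum : 2 * bsum N (fun e => strsum a N (fun t => Nat.b2n (A e N t) * P t w)) <= a ^ N).
    { rewrite <- bsum_mul_l; apply bsum_geom; intros e He.
      specialize (Hb e He); specialize (Hstage e N m Hm); fold w in Hstage.
      apply (Nat.mul_le_mono_pos_l _ _ (a ^ (m - N))).
      { pose proof (Nat.pow_nonzero a (m - N)); lia. }
      rewrite <- Nat.pow_add_r, Nat.sub_add by assumption.
      eapply Nat.le_trans; [|exact Hb].
      eapply Nat.le_trans; [|apply Nat.mul_le_mono_l, Hstage].
      rewrite Nat.pow_add_r; change (2 ^ 2) with 4; rewrite Nat.pow_succ_r'.
      apply Nat.eq_le_incl; ring. }
    apply NNPP; intros Hn.
    assert (Hall : strsum a N (fun t => P t w)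
                   <= bsum N (fun e => strsum a N (fun t => Nat.b2n (A e N t) * P t w))).
    { rewrite <- strsum_bsum; apply strsum_le; intros t Ht HN.
      destruct (Nat.eq_0_gt_0_cases (P t w)) as [E|E]; [lia|].
      destruct (bad N t) eqn:Eb; [|exfalso; apply Hn; exists t; repeat split; eauto].
      apply existsb_exists in Eb as (e & He & Ee); apply in_seq in He.
      pose proof (bsum_term N (fun e => Nat.b2n (A e N t) * P t w) e) as Hterm.
      cbv beta in Hterm; rewrite Ee in Hterm; simpl Nat.b2n in Hterm; lia. }
    rewrite (coupling_total_l a b P N w HP Hw) in Hall.
    pose proof (Nat.pow_nonzero a N); lia. }
  destruct (koenig a (fun N t => bad N t = false /\ exists m, N <= m /\ 0 < P t (prefix z m)))
    as (y & Hy & HK).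
  { intros K; destruct (Hex K) as (t & H1 & H2 & H3 & H4); exists t; auto. }
  exists y; split; auto; split.
  - intros N M; destruct (HK N M) as (K & t & HM & HN & Ht & Hw & (_ & m & Hm & Hpos) & Hf).
    apply (coupling_pos_prefix a b P t (prefix z m) y N z M m); auto; lia.
  - intros e N He; destruct (A e N (prefix y N)) eqn:E; auto; exfalso.
    destruct (HK N N) as (K & t & _ & HN & Ht & Hw & (Hbad & _) & Hf).
    (* A bad prefix of [y] would make bad the longer good word that [koenig] supplies above it. *)
    assert (Hext : forall s N t, A e N t = true -> A e (N + length s) (t ++ s) = true).
    { clear - Hmono; induction s as [|d s IH]; intros N t H; simpl.
      - now rewrite Nat.add_0_r, app_nil_r.
      - rewrite Nat.add_succ_r, <- Nat.add_succ_l.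
        change (d :: s) with ([d] ++ s); rewrite app_assoc; auto. }
    specialize (Hext (skipn N t) N _ E); rewrite <- Hf, firstn_skipn, length_skipn in Hext.
    replace (N + (length t - N)) with K in Hext by lia.
    assert (Hb : bad K t = true); [|congruence].
    apply existsb_exists; exists e; split; auto; apply in_seq; lia.
Qed.

(** * Random points have random partners *)

(** Written with a bounded quantifier over positions, so that [pr] applies once [s] and [t] are
    decoded strings. *)
Definition prefixb (s t : list nat) : bool :=
  (length s <=? length t) && forallb (fun p => nth p s 0 =? nth p t 0) (seq 0 (length s)).

Lemma prefixb_spec s t :
  prefixb s t = true <-> firstn (length s) t = s /\ length s <= length t.
Proof.
  unfold prefixb; rewrite Bool.andb_true_iff, Nat.leb_le, forallb_forall; split.
  - intros [Hl H]; split; auto.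
    apply nth_ext with 0 0; [now apply firstn_length_le|].
    rewrite firstn_length_le by assumption; intros n Hn.
    rewrite nth_firstn; destruct (Nat.ltb_spec n (length s)); [|lia].
    specialize (H n); symmetry; apply Nat.eqb_eq, H, in_seq; lia.
  - intros [H Hl]; split; auto; intros p Hp; apply in_seq in Hp.
    apply Nat.eqb_eq; rewrite <- H at 1; rewrite nth_firstn.
    destruct (Nat.ltb_spec p (length s)); auto; lia.
Qed.

(** The decidable approximation of a test set after [K] steps of its enumeration; [K] will be the
    length of [t]. *)
Definition hit (a : nat) (Rf : prf) (i K : nat) (t : list nat) : bool :=
  existsb (fun k => if prf_eval Rf [i; k] =? 0 then false
                    else prefixb (decode_str a (pred (prf_eval Rf [i; k]))) t) (seq 0 K).

Lemma hit_spec a Rf i K t :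
  hit a Rf i K t = true <->
  exists k m, k < K /\ prf_eval Rf [i; k] = S m /\ prefixb (decode_str a m) t = true.
Proof.
  unfold hit; rewrite existsb_exists; split.
  - intros (k & Hk & H); apply in_seq in Hk.
    destruct (prf_eval Rf [i; k]) as [|m] eqn:E; [discriminate|].
    exists k, m; repeat split; auto; lia.
  - intros (k & m & Hk & E & H); exists k; rewrite E; split; auto; apply in_seq; lia.
Qed.

Lemma hit_mono a Rf i K t d : hit a Rf i K t = true -> hit a Rf i (S K) (t ++ [d]) = true.
Proof.
  rewrite !hit_spec; intros (k & m & Hk & E & H); exists k, m; repeat split; auto.
  apply prefixb_spec in H as [H Hl]; apply prefixb_spec; rewrite length_app; split; [|lia].
  rewrite firstn_app, H; replace (_ - _) with 0 by lia; apply app_nil_r.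
Qed.

Lemma hit_has_prefix a Rf i K t :
  hit a Rf i K t = true -> has_prefix_in (test_set a Rf i) t = true.
Proof.
  rewrite hit_spec, has_prefix_in_spec; intros (k & m & _ & E & H).
  apply prefixb_spec in H as [H Hl]; exists (decode_str a m); repeat split; auto.
  exists k, m; auto.
Qed.

Lemma in_open_hit a Rf i y :
  in_open (test_set a Rf i) y -> exists N0, forall N, N0 <= N -> hit a Rf i N (prefix y N) = true.
Proof.
  intros (s & (k & m & E & <-) & Hs); exists (S (k + length (decode_str a m))); intros N HN.
  apply hit_spec; exists k, m; repeat split; auto; [lia|]; apply prefixb_spec.
  rewrite length_prefix, firstn_prefix by lia; split; [assumption|lia].
Qed.

(* A weighted sum over [j] of the conditional measures, given [w], of the stage
   [length w] approximations of the test sets of index [2 j + 1]. *)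
Definition test_weight (a : nat) (P : list nat -> list nat -> nat) (Rf : prf) (w : list nat) :=
  bsum (length w) (fun j => 2 ^ j * strsum a (length w)
    (fun t => Nat.b2n (hit a Rf (2 * j + 1) (length w) t) * P t w)).

Lemma PR_test_weight a b P Rf :
  PR 2 (fun l => P (decode_str a (hd 0 l)) (decode_str b (hd 0 (tl l)))) ->
  PR 1 (fun l => test_weight a P Rf (decode_str b (hd 0 l))).
Proof.
  intros HP; unfold test_weight; pr.
  apply (PR_strsum a 2 (fun l => length (decode_str b (hd 0 (tl l))))
    (fun t l => Nat.b2n (hit a Rf (2 * hd 0 l + 1) (length (decode_str b (hd 0 (tl l)))) t)
                * P t (decode_str b (hd 0 (tl l))))); pr.
  - unfold hit, prefixb; pr.
  - apply (PR_comp2 3 (fun c k => P (decode_str a c) (decode_str b k))); [exact HP|pr|pr].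
Qed.

(** A further letter of [w] lengthens the words [t], advances the stage of [hit] and adds a term to
    the sum. The first is neutral by the two laws of the coupling, the other two only increase the
    value. *)
Lemma test_weight_submartingale a b P Rf w :
  coupling a b P -> word b w ->
  a * b * test_weight a P Rf w <= bsum b (fun d => test_weight a P Rf (w ++ [d])).
Proof.
  intros HP Hw; unfold test_weight; set (N := length w).
  rewrite <- bsum_mul_l.
  apply Nat.le_trans with (bsum b (fun d => bsum N (fun j => 2 ^ j * strsum a (S N)
    (fun t => Nat.b2n (hit a Rf (2 * j + 1) (S N) t) * P t (w ++ [d]))))).
  - rewrite bsum_swap; apply bsum_le; intros j _; rewrite bsum_mul_l.
    replace (a * b * (2 ^ j * strsum a N (fun t => Nat.b2n (hit a Rf (2 * j + 1) N t) * P t w)))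
      with (2 ^ j * (a * b * strsum a N (fun t => Nat.b2n (hit a Rf (2 * j + 1) N t) * P t w)))
      by ring.
    apply Nat.mul_le_mono_l; rewrite <- strsum_bsum.
    rewrite (strsum_ext a (S N) _ (fun t => b * (Nat.b2n (hit a Rf (2 * j + 1) (S N) t) * P t w))).
    2:{ intros t Ht _; rewrite bsum_mul_l, (coupling_snoc_r _ _ _ HP) by assumption; ring. }
    rewrite strsum_snoc, <- strsum_mul_l; apply strsum_le; intros t Ht _.
    cbv beta; rewrite bsum_mul_l.
    replace (a * b * (Nat.b2n (hit a Rf (2 * j + 1) N t) * P t w))
      with (b * (Nat.b2n (hit a Rf (2 * j + 1) N t) * (a * P t w))) by ring.
    apply Nat.mul_le_mono_l; rewrite <- (coupling_snoc_l _ _ _ HP), <- bsum_mul_l by assumption.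
    apply bsum_le; intros d _; apply Nat.mul_le_mono_r.
    destruct (hit a Rf (2 * j + 1) N t) eqn:E; [rewrite hit_mono; auto|simpl; lia].
  - apply bsum_le; intros d _; rewrite length_app, Nat.add_1_r; fold N; cbn [bsum]; lia.
Qed.

(** Averaging over [w] turns conditional measures into uniform ones. The set of index 2j+1 then
    contributes at most 2^j 2^-(2j+1) = 2^-(j+1), which sums to at most 1 although the weights 2^j
    are unbounded. *)
Lemma test_weight_sum a b P Rf L :
  0 < a -> coupling a b P ->
  (forall i, (lambda_open a (test_set a Rf i) <= (/ 2) ^ i)%R) ->
  strsum b L (test_weight a P Rf) <= (a * b) ^ L.
Proof.
  intros Ha HP Hlam.
  rewrite (strsum_ext _ _ _ (fun w => bsum L (fun j => 2 ^ j * strsum a L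
    (fun t => Nat.b2n (hit a Rf (2 * j + 1) L t) * P t w)))).
  2:{ intros w _ <-; reflexivity. }
  rewrite strsum_bsum; apply bsum_geom; intros j _.
  rewrite strsum_mul_l, <- strsum_swap.
  rewrite (strsum_ext _ _ _ (fun t => b ^ L * Nat.b2n (hit a Rf (2 * j + 1) L t))).
  2:{ intros t Ht _; rewrite strsum_mul_l.
      rewrite (coupling_total_l b a (fun w t => P t w)); [ring|now apply coupling_sym|assumption]. }
  rewrite strsum_mul_l, Nat.pow_mul_l.
  pose proof (lambda_open_ge a (test_set a Rf (2 * j + 1)) (2 * j + 1) L Ha (Hlam _)) as H.
  assert (Hle : strsum a L (fun t => Nat.b2n (hit a Rf (2 * j + 1) L t)) <=
    strsum a L (fun t => Nat.b2n (has_prefix_in (test_set a Rf (2 * j + 1)) t))).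
  { apply strsum_le; intros t _ _; destruct (hit _ _ _ _ _) eqn:E; [|simpl; lia].
    now rewrite (hit_has_prefix _ _ _ _ _ E). }
  apply (Nat.mul_le_mono_l _ _ (2 ^ (2 * j + 1))) in Hle.
  replace (2 ^ (2 * j + 1)) with (2 ^ S j * 2 ^ j) in *
    by (rewrite <- Nat.pow_add_r; f_equal; lia).
  rewrite (Nat.mul_comm (a ^ L)).
  rewrite (Nat.mul_comm (2 ^ j)), !Nat.mul_assoc, (Nat.mul_comm _ (b ^ L)), <- !Nat.mul_assoc.
  apply Nat.mul_le_mono_l; lia.
Qed.

Theorem coupling_random a b P z :
  0 < a -> 0 < b -> coupling a b P ->
  PR 2 (fun l => P (decode_str a (hd 0 l)) (decode_str b (hd 0 (tl l)))) ->
  ML_random b z ->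
  exists y, ML_random a y /\ forall N M, 0 < P (prefix y N) (prefix z M).
Proof.
  intros Ha Hb HP HPR Hz; destruct prf_countable as [E HE].
  set (valid := fun e => forall i, (lambda_open a (test_set a (E e) i) <= (/ 2) ^ i)%R).
  assert (HJ : forall e, exists J, valid e -> forall m, J < m ->
    2 ^ (e + 2) * strsum a m (fun t => Nat.b2n (hit a (E e) (2 * J + 1) m t) * P t (prefix z m))
    <= a ^ m).
  { intros e; destruct (classic (valid e)) as [Hv|Hv]; [|exists 0; tauto].
    destruct (ML_random_submartingale a b z (test_weight a P (E e))) as [i Hi]; auto.
    - now apply PR_test_weight.
    - intros w Hw; now apply test_weight_submartingale.
    - intros L; now apply test_weight_sum.
    (* The whole sum is at most 2^i along [z], so the term of weight 2^j has conditional measure at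
       most 2^(i-j), here 2^-(e+2). *)
    - exists (i + (e + 2)); intros _ m Hm; specialize (Hi m).
      unfold test_weight in Hi; rewrite length_prefix in Hi.
      pose proof (bsum_term m (fun j => 2 ^ j * strsum a m (fun t =>
        Nat.b2n (hit a (E e) (2 * j + 1) m t) * P t (prefix z m))) _ Hm) as Ht.
      cbv beta in Ht; rewrite Nat.pow_add_r in Ht; pose proof (Nat.pow_nonzero 2 i).
      apply (Nat.mul_le_mono_pos_l _ _ (2 ^ i)); [lia|].
      rewrite Nat.mul_assoc; lia. }
  (* [J] is not computable in general; it serves only to select the partner and enters no test. *)
  set (J := fun e => proj1_sig (constructive_indefinite_description _ (HJ e))).
  assert (HJ' : forall e, valid e -> forall m, J e < m ->
    2 ^ (e + 2) * strsum a m (fun t => Nat.b2n (hit a (E e) (2 * J e + 1) m t) * P t (prefix z m))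
    <= a ^ m).
  { intros e; unfold J; now destruct (constructive_indefinite_description _ (HJ e)). }
  clearbody J; clear HJ.
  (* Programs that violate the measure bound are not tests and are given the empty set. *)
  set (A := fun e N t => if excluded_middle_informative (valid e)
                         then hit a (E e) (2 * J e + 1) N t else false).
  destruct (coupling_avoid a b P z A) as (y & Hy & Hpos & Hav); auto; unfold A in *.
  - apply Hz.
  - intros e N t d; destruct (excluded_middle_informative (valid e)); auto; apply hit_mono.
  - intros e; destruct (excluded_middle_informative (valid e)) as [Hv|Hv].
    + exists (S (J e)); intros m Hm; apply HJ'; auto.
    + exists 0; intros m _; rewrite (strsum_ext _ _ _ (fun _ => 0)), strsum_const by reflexivity; lia.
  - exists y; split; auto; split; auto; intros Rf Hlam Hin.
    destruct (HE Rf) as [e <-]; specialize (Hin (2 * J e + 1)).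
    apply in_open_hit in Hin as [N0 HN0]; specialize (Hav e (S (e + N0))).
    destruct (excluded_middle_informative (valid e)) as [Hv|Hv]; [|contradiction].
    rewrite HN0 in Hav by lia; discriminate Hav; lia.
Qed.

(** * Columns of a random sequence *)

Lemma pairing_cantor n k : pairing n k = Cantor.to_nat (n, k).
Proof.
  unfold pairing; pose proof (Cantor.to_nat_spec n k) as H.
  replace ((n + k) * (n + k + 1)) with ((Cantor.to_nat (n, k) - k) * 2) by nia.
  rewrite Nat.div_mul by lia; nia.
Qed.

Lemma pairing_inj n k n' k' : pairing n k = pairing n' k' -> n = n'.
Proof. rewrite !pairing_cantor; intros H; apply Cantor.to_nat_inj in H; congruence. Qed.

Lemma pairing_ge n k : n <= pairing n k.
Proof. rewrite pairing_cantor; pose proof (Cantor.to_nat_non_decreasing n k); lia. Qed.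

Lemma pairing_lt n k k' : k < k' -> pairing n k < pairing n k'.
Proof.
  intros H; rewrite !pairing_cantor.
  pose proof (Cantor.to_nat_spec n k); pose proof (Cantor.to_nat_spec n k'); nia.
Qed.

(* The positions [pairing n k < N] are those with [k < col_len n N], and
   [col_num f n N] is the number with binary digits [f (pairing n k)] there. *)
Fixpoint col_len (n N : nat) : nat :=
  match N with
  | O => 0
  | S p => if p =? pairing n (col_len n p) then S (col_len n p) else col_len n p
  end.

Fixpoint col_num (f : nat -> nat) (n N : nat) : nat :=
  match N with
  | O => 0
  | S p => if p =? pairing n (col_len n p) then 2 * col_num f n p + f p else col_num f n p
  end.

Lemma PR_col_len k n N : PR k n -> PR k N -> PR k (fun l => col_len (n l) (N l)).
Proof.
  apply (PR_comp2 k col_len).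
  apply (PR_rec 2 (fun l N => col_len (hd 0 l) N) (fun _ => 0)
    (fun p r l => if p =? pairing (hd 0 l) r then S r else r) (fun l => hd 0 (tl l)));
    auto; unfold pairing; pr.
Qed.

Lemma PR_col_num k c n N : PR k c -> PR k n -> PR k N ->
  PR k (fun l => col_num (fun p => nth p (decode_str 2 (c l)) 0) (n l) (N l)).
Proof.
  apply (PR_comp3 k (fun c n N => col_num (fun p => nth p (decode_str 2 c) 0) n N)).
  apply (PR_rec 3 (fun l N => col_num (fun p => nth p (decode_str 2 (hd 0 l)) 0) (hd 0 (tl l)) N)
    (fun _ => 0) (fun p r l => if p =? pairing (hd 0 (tl l)) (col_len (hd 0 (tl l)) p)
                               then 2 * r + nth p (decode_str 2 (hd 0 l)) 0 else r)
    (fun l => hd 0 (tl (tl l)))); auto; try pr_var; [pr|].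
  unfold pairing; pr; apply PR_col_len; pr.
Qed.

Lemma col_len_spec n N k : pairing n k < N <-> k < col_len n N.
Proof.
  revert k; induction N as [|N IH]; intros k; simpl; [lia|].
  assert (Hk : pairing n k < S N <-> pairing n k = N \/ k < col_len n N)
    by (rewrite <- IH; lia).
  rewrite Hk; destruct (Nat.eqb_spec N (pairing n (col_len n N))) as [E|E].
  - split; [intros [H|H]; [|lia]|intros H].
    + destruct (Nat.lt_total k (col_len n N)) as [|[->|H']]; [lia|lia|].
      apply (pairing_lt n) in H'; lia.
    + destruct (Nat.eq_dec k (col_len n N)) as [->|]; [left; congruence|right; lia].
  - split; [intros [H|H]; [|exact H]|auto].
    destruct (Nat.lt_total k (col_len n N)) as [|[->|H']]; [lia|congruence|].
    apply (pairing_lt n) in H'; specialize (IH (col_len n N)); lia.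
Qed.

Lemma col_len_small n N : N <= n -> col_len n N = 0.
Proof.
  intros H; destruct (col_len n N) as [|m] eqn:E; auto.
  assert (H0 : pairing n 0 < N) by (apply col_len_spec; lia).
  pose proof (pairing_ge n 0); lia.
Qed.

Lemma col_num_ext f g n N : (forall p, p < N -> f p = g p) -> col_num f n N = col_num g n N.
Proof.
  induction N as [|N IH]; intros H; simpl; auto.
  rewrite IH by auto; destruct (_ =? _); auto.
Qed.

Lemma col_num_small f n N : N <= n -> col_num f n N = 0.
Proof.
  induction N as [|N IH]; intros H; simpl; auto.
  rewrite IH, col_len_small by lia; pose proof (pairing_ge n 0).
  destruct (Nat.eqb_spec N (pairing n 0)); lia.
Qed.

Lemma col_num_lt f n N : (forall p, f p < 2) -> col_num f n N < 2 ^ col_len n N.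
Proof.
  intros Hf; induction N as [|N IH]; simpl; [lia|].
  specialize (Hf N); destruct (_ =? _); auto; rewrite Nat.pow_succ_r'; lia.
Qed.

(** * Columns as real numbers, and why they avoid 1/3 and 2/3 *)

Definition binary_term (y : nat -> bool) (k : nat) : R :=
  if y k then ((/ 2) ^ (S k))%R else 0%R.

Definition binary_real (y : nat -> bool) : R := Series (binary_term y).

Lemma binary_term_bounds y k : (0 <= binary_term y k <= (/ 2) ^ (S k))%R.
Proof.
  unfold binary_term; assert (0 < (/ 2) ^ (S k))%R by (apply pow_lt; lra); destruct (y k); lra.
Qed.

Lemma is_series_half_pow : is_series (fun k => (/ 2) ^ (S k))%R 1%R.
Proof.
  replace 1%R with (/ 2 * / (1 - / 2))%R by field.
  apply (is_series_ext (fun k => (/ 2 * (/ 2) ^ k)%R)); [reflexivity|].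
  assert (H : (Rabs (/ 2) < 1)%R) by (rewrite Rabs_pos_eq; lra).
  exact (is_series_scal_l (/ 2)%R _ _ (is_series_geom (/ 2)%R H)).
Qed.

Lemma ex_series_binary y : ex_series (binary_term y).
Proof.
  apply (@ex_series_le R_AbsRing R_CompleteNormedModule _ (fun k => (/ 2) ^ (S k))%R);
    [|now exists 1%R; apply is_series_half_pow].
  intros k; pose proof (binary_term_bounds y k).
  change (Rabs (binary_term y k) <= (/ 2) ^ S k)%R.
  rewrite Rabs_pos_eq; apply H.
Qed.

Lemma binary_real_bounds y : (0 <= binary_real y <= 1)%R.
Proof.
  unfold binary_real; split.
  - apply Rle_trans with (Series (fun k => 0 * (/ 2) ^ S k))%R; [rewrite Series_scal_l; lra|].
    apply Series_le; [|apply ex_series_binary].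
    intros k; rewrite Rmult_0_l; split; [lra|apply binary_term_bounds].
  - rewrite <- (is_series_unique _ _ is_series_half_pow).
    apply Series_le; [apply binary_term_bounds|now exists 1%R; apply is_series_half_pow].
Qed.

Lemma binary_real_double y :
  (2 * binary_real y = INR (Nat.b2n (y 0%nat)) + binary_real (fun k => y (S k)))%R.
Proof.
  unfold binary_real; rewrite (Series_incr_1 _ (ex_series_binary y)).
  rewrite Rmult_plus_distr_l; f_equal.
  - unfold binary_term; destruct (y 0); simpl; field.
  - rewrite <- Series_scal_l; apply Series_ext; intros k; unfold binary_term.
    destruct (y (S k)); [simpl; field|ring].
Qed.

Lemma column_real_expansion x n N :
  (2 ^ col_len n N * column_real x n
   = INR (col_num (bits x) n N) + binary_real (fun k => x (pairing n (col_len n N + k))))%R.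
Proof.
  induction N as [|N IH]; cbn [col_len col_num].
  - cbn [pow INR]; rewrite Rmult_1_l, Rplus_0_l; reflexivity.
  - destruct (Nat.eqb_spec N (pairing n (col_len n N))) as [E|E]; [|exact IH].
    cbn [pow]; rewrite Rmult_assoc, IH, Rmult_plus_distr_l, binary_real_double, plus_INR, mult_INR.
    rewrite Nat.add_0_r, <- E, Rplus_assoc.
    apply Rplus_eq_compat_l, f_equal2; [unfold bits; now destruct (x N)|].
    unfold binary_real; apply Series_ext; intros k; unfold binary_term.
    now replace (col_len n N + S k) with (S (col_len n N + k)) by lia.
Qed.

Lemma column_real_bounds x n N :
  (INR (col_num (bits x) n N) <= 2 ^ col_len n N * column_real x n
   <= INR (col_num (bits x) n N) + 1)%R.
Proof. rewrite column_real_expansion; pose proof (binary_real_bounds (fun k => x (pairing n (col_len n N + k)))); lra. Qed.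

Lemma column_real_unit x n : (0 <= column_real x n <= 1)%R.
Proof. exact (binary_real_bounds (fun k => x (pairing n k))). Qed.

(* The fair martingale betting that column [n] is the binary expansion of [c / 3]. *)
Definition third_martingale (c n : nat) (s : list nat) : nat :=
  if col_num (fun p => nth p s 0) n (length s) =? c * 2 ^ col_len n (length s) / 3
  then 2 ^ col_len n (length s) else 0.

Lemma PR_third_martingale c n : PR 1 (fun l => third_martingale c n (decode_str 2 (hd 0 l))).
Proof.
  unfold third_martingale; pr; try apply PR_col_num; try apply PR_col_len; pr.
Qed.

(** If the next position belongs to column [n], a correct guess has exactly one correct extension,
    as floor(2q) is 2 floor(q) or one more, and the stake doubles there. Otherwise nothing
    changes. *)
Lemma third_martingale_fair c n s :
  bsum 2 (fun d => third_martingale c n (s ++ [d])) = 2 * third_martingale c n s.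
Proof.
  unfold third_martingale; cbn [bsum]; rewrite !length_app, !Nat.add_1_r.
  cbn [col_num col_len]; rewrite !nth_middle.
  assert (E : forall d, col_num (fun p => nth p (s ++ [d]) 0) n (length s)
              = col_num (fun p => nth p s 0) n (length s)).
  { intros d; apply col_num_ext; intros p Hp; now apply app_nth1. }
  rewrite !E; destruct (_ =? pairing _ _); [|lia].
  rewrite Nat.pow_succ_r'; set (A := 2 ^ col_len n (length s)); set (u := col_num _ _ _).
  pose proof (Nat.div_mod_eq (c * A) 3); pose proof (Nat.mod_upper_bound (c * A) 3).
  pose proof (Nat.div_mod_eq (c * (2 * A)) 3); pose proof (Nat.mod_upper_bound (c * (2 * A)) 3).
  destruct (Nat.eqb_spec u (c * A / 3)), (Nat.eqb_spec (2 * u + 0) (c * (2 * A) / 3)),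
    (Nat.eqb_spec (2 * u + 1) (c * (2 * A) / 3)); lia.
Qed.

Lemma pow2_mod3 l : 2 ^ l mod 3 = 1 \/ 2 ^ l mod 3 = 2.
Proof.
  induction l as [|l IH]; [now left|]; rewrite Nat.pow_succ_r', Nat.Div0.mul_mod.
  destruct IH as [->| ->]; auto.
Qed.

(** The number c/3 is not dyadic, so a column equal to it would have its unique binary digits, and
    the martingale would double at every digit. *)
Lemma column_not_third c x n :
  c = 1 \/ c = 2 -> ML_random 2 (bits x) -> column_real x n <> (INR c / 3)%R.
Proof.
  intros Hc Hx Heq.
  destruct (ML_random_submartingale 1 2 (bits x) (third_martingale c n)) as [i Hi]; auto.
  - apply PR_third_martingale.
  - intros w _; rewrite third_martingale_fair; lia.
  - induction L as [|L IH].
    + destruct Hc as [-> | ->]; apply le_n.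
    + rewrite strsum_snoc, (strsum_ext _ _ _ (fun s => 2 * third_martingale c n s))
        by (intros; apply third_martingale_fair).
      rewrite strsum_mul_l, Nat.pow_succ_r'; lia.
  (* At this length more than [i] digits of the column are known, so the capital exceeds 2^i. *)
  - set (N := S (pairing n i)); specialize (Hi N).
    rewrite Nat.pow_1_l, Nat.mul_1_r in Hi.
    unfold third_martingale in Hi; rewrite length_prefix in Hi.
    rewrite (col_num_ext _ (bits x)) in Hi by (intros; now apply nth_prefix).
    assert (Hlen : i < col_len n N) by (apply col_len_spec; unfold N; lia).
    pose proof (column_real_bounds x n N) as Hb; rewrite Heq in Hb.
    set (u := col_num (bits x) n N) in *.
    (* The bounds on the column still allow c 2^l = 3u + 3, where l is the number of digits; this is
       excluded because 3 does not divide c 2^l. *)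
    assert (Hu : u = c * 2 ^ col_len n N / 3).
    { assert (H : 3 * u <= c * 2 ^ col_len n N <= 3 * u + 3).
      { split; apply INR_le; rewrite ?plus_INR, !mult_INR, pow_INR;
          change (INR 2) with 2%R; simpl (INR 3); lra. }
      pose proof (pow2_mod3 (col_len n N)).
      pose proof (Nat.div_mod_eq (2 ^ col_len n N) 3).
      apply (Nat.div_unique _ _ _ (c * 2 ^ col_len n N - 3 * u)); destruct Hc; subst c; lia. }
    rewrite <- Hu, Nat.eqb_refl in Hi; apply Nat.pow_le_mono_r_iff in Hi; lia.
Qed.

(** * The density of the labelling *)

(** A column is the conditional probability of the left child. Label 0 (left only) belongs to the
    upper third, label 1 (right only) to the lower, label 2 (both) to the middle. *)
Definition label_third (d : nat) : nat := (d + 2) mod 3.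

(* The length of [u / A, (u+1) / A] meets [a/3, (a+1)/3], in units of [1 / (3 A)],
   where [a] is the third of the unit interval that yields label [d]. *)
Definition third_overlap (u A d : nat) : nat :=
  Nat.min (3 * u + 3) ((label_third d + 1) * A) - Nat.max (3 * u) (label_third d * A).

(** A column without known digits contributes nothing. One unit is the product of the lengths 1/A
    and 1/3, so the overlap already is the ratio of joint mass to product mass. *)
Lemma third_overlap_root d : third_overlap 0 1 d = 1.
Proof.
  unfold third_overlap; assert (label_third d < 3) by (apply Nat.mod_upper_bound; lia); lia.
Qed.

(** The thirds partition the unit interval. Together with [third_overlap_split], which halves the
    digit interval, this yields the one-letter laws of the coupling. *)
Lemma third_overlap_labels u A : u < A -> bsum 3 (third_overlap u A) = 3.
Proof.
  intros H; cbn [bsum]; unfold third_overlap.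
  change (label_third 0) with 2; change (label_third 1) with 0; change (label_third 2) with 1; lia.
Qed.

Lemma third_overlap_split u A d :
  bsum 2 (fun e => third_overlap (2 * u + e) (2 * A) d) = 2 * third_overlap u A d.
Proof. cbn [bsum]; unfold third_overlap; lia. Qed.

(** * Membership and rank in the tree of a labelling *)

Definition allowed (d : nat) (b : bool) : bool := if b then negb (d =? 0) else negb (d =? 1).

(** The label of a node is found through its rank, hence through all earlier nodes. Packing their
    membership into the bits of one number turns this course-of-values recursion into a primitive
    one. *)
Definition mask_bit (B p : nat) : bool := Nat.odd (B / 2 ^ p).

Definition mask_rank (B p : nat) : nat := bsum p (fun m => Nat.b2n (mask_bit B m)).

(* [mask z n] has bit [m < n] set iff node [m] belongs to the tree labelled by
   [z]; the parent of node [m + 1] is node [m / 2]. *)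
Definition node_in (z : nat -> nat) (B n : nat) : bool :=
  if n =? 0 then true
  else mask_bit B (pred n / 2) && allowed (z (mask_rank B (pred n / 2))) (Nat.odd (pred n)).

Fixpoint mask (z : nat -> nat) (n : nat) : nat :=
  match n with O => 0 | S m => mask z m + (if node_in z (mask z m) m then 2 ^ m else 0) end.

Definition in_tree (z : nat -> nat) (n : nat) : bool := node_in z (mask z n) n.

Definition rank (z : nat -> nat) (n : nat) : nat := mask_rank (mask z n) n.

Lemma mask_bits z n : mask z n < 2 ^ n /\ forall m, m < n -> mask_bit (mask z n) m = in_tree z m.
Proof.
  induction n as [|n [IH1 IH2]]; [simpl; split; [lia|intros; lia]|].
  cbn [mask]; fold (in_tree z n); set (e := in_tree z n).
  replace (if e then 2 ^ n else 0) with (Nat.b2n e * 2 ^ n) by (destruct e; simpl; lia).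
  split; [rewrite Nat.pow_succ_r'; destruct e; simpl; lia|].
  intros m Hm; unfold mask_bit in *; destruct (Nat.eq_dec m n) as [->|E].
  - rewrite Nat.div_add by (apply Nat.pow_nonzero; lia).
    rewrite Nat.div_small by assumption; fold e; now destruct e.
  - rewrite <- IH2 by lia.
    replace (Nat.b2n e * 2 ^ n) with (Nat.b2n e * 2 ^ (n - m - 1) * 2 * 2 ^ m).
    2:{ rewrite <- !Nat.mul_assoc, <- Nat.pow_succ_r', <- Nat.pow_add_r.
        do 2 f_equal; lia. }
    rewrite Nat.div_add by (apply Nat.pow_nonzero; lia).
    now rewrite Nat.odd_add, Nat.odd_mul, Bool.andb_false_r, Bool.xorb_false_r.
Qed.

Lemma rank_sum z n : rank z n = bsum n (fun m => Nat.b2n (in_tree z m)).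
Proof. apply bsum_ext; intros m Hm; now rewrite (proj2 (mask_bits z n)). Qed.

Lemma rank_S z n : rank z (S n) = rank z n + Nat.b2n (in_tree z n).
Proof. now rewrite !rank_sum. Qed.

Lemma rank_le z n m : n <= m -> rank z n <= rank z m.
Proof. induction 1 as [|m _ IH]; auto; rewrite rank_S; lia. Qed.

Lemma rank_lt z n m : n < m -> in_tree z n = true -> rank z n < rank z m.
Proof.
  intros H E; pose proof (rank_le z (S n) m H) as H'; rewrite rank_S, E in H'; simpl in H'; lia.
Qed.

Lemma half_le m : m / 2 <= m.
Proof. apply Nat.Div0.div_le_upper_bound; lia. Qed.

Lemma in_tree_S z m :
  in_tree z (S m) = in_tree z (m / 2) && allowed (z (rank z (m / 2))) (Nat.odd m).
Proof.
  unfold in_tree at 1, node_in; cbn [Nat.eqb pred].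
  pose proof (half_le m); rewrite (proj2 (mask_bits z (S m))) by lia; do 3 f_equal.
  rewrite rank_sum; apply bsum_ext; intros p Hp; now rewrite (proj2 (mask_bits z (S m))) by lia.
Qed.

(** Membership of [n] is decided by labels of tree nodes before [n], and these have smaller rank. It
    is enough to bound the rank under one labelling, since the induction carries the bound to the
    other. *)
Lemma tree_agree z z' M n :
  (forall i, i < M -> z i = z' i) -> rank z n <= M \/ rank z' n <= M ->
  in_tree z n = in_tree z' n /\ rank z n = rank z' n.
Proof.
  intros Hz; induction n as [n IH] using lt_wf_ind; intros Hr.
  assert (Hin : forall m, m < n -> in_tree z m = in_tree z' m /\ rank z m = rank z' m).
  { intros m Hm; apply IH; auto; destruct Hr as [Hr|Hr]; [left|right];
      eapply Nat.le_trans; try exact Hr; apply rank_le; lia. }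
  split; [|rewrite !rank_sum; apply bsum_ext; intros m Hm; now rewrite (proj1 (Hin m Hm))].
  destruct n as [|m]; [reflexivity|].
  pose proof (half_le m); assert (Hp : m / 2 < S m) by lia.
  rewrite !in_tree_S; destruct (Hin _ Hp) as [E1 E2].
  destruct (in_tree z (m / 2)) eqn:E; rewrite <- E1; [|reflexivity].
  rewrite <- E2, Hz; auto.
  pose proof (rank_lt z _ _ Hp E); pose proof (rank_lt z' _ _ Hp (eq_sym E1)); lia.
Qed.

(* The number by which the measure of the cylinder of length [N] around [f]
   is multiplied when conditioning on the first [M] labels being those of [z]. *)
Definition density_fun (f : nat -> nat) (N : nat) (z : nat -> nat) (M : nat) : nat :=
  bprod N (fun n => if in_tree z n && (rank z n <? M)
                    then third_overlap (col_num f n N) (2 ^ col_len n N) (z (rank z n)) else 1).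

Definition density (s w : list nat) : nat :=
  density_fun (fun p => nth p s 0) (length s) (fun i => nth i w 0) (length w).

Lemma bprod_ext n f g : (forall i, i < n -> f i = g i) -> bprod n f = bprod n g.
Proof. induction n as [|n IH]; intros H; simpl; [|rewrite IH, H]; auto. Qed.

(** The shape of both one-letter laws: a new letter affects a single factor, and the others can be
    taken out of the sum. *)
Lemma bprod_bsum_one b N n0 c (F : nat -> nat -> nat) (F0 : nat -> nat) :
  n0 < N -> (forall d n, d < b -> n < N -> n <> n0 -> F d n = F0 n) ->
  bsum b (fun d => F d n0) = c * F0 n0 ->
  bsum b (fun d => bprod N (F d)) = c * bprod N F0.
Proof.
  intros Hn HF Hs; induction N as [|N IH]; [lia|]; cbn [bprod].
  destruct (Nat.eq_dec n0 N) as [->|E].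
  - rewrite (bsum_ext b _ (fun d => bprod N F0 * F d N)).
    + rewrite bsum_mul_l, Hs; ring.
    + intros d Hd; f_equal; apply bprod_ext; intros i Hi; apply HF; auto; lia.
  - rewrite (bsum_ext b _ (fun d => F0 N * bprod N (F d))).
    + rewrite bsum_mul_l, IH; [ring|lia|auto].
    + intros d Hd; rewrite HF by (auto; lia); ring.
Qed.

(** A node on which the labellings disagree has rank above [M] under both and contributes 1 to
    either product. Hence the default 0 in [density] has no effect. *)
Lemma density_fun_ext f f' N z z' M :
  (forall p, p < N -> f p = f' p) -> (forall i, i < M -> z i = z' i) ->
  density_fun f N z M = density_fun f' N z' M.
Proof.
  intros Hf Hz; apply bprod_ext; intros n Hn.
  rewrite (col_num_ext f f') by assumption.
  destruct (Nat.leb_spec (rank z n) M) as [H|H];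
    [|destruct (Nat.leb_spec (rank z' n) M) as [H'|H']].
  - destruct (tree_agree z z' M n Hz (or_introl H)) as [-> ->].
    destruct (in_tree z' n); auto; cbn [andb].
    destruct (Nat.ltb_spec (rank z' n) M); auto; now rewrite Hz.
  - destruct (tree_agree z z' M n Hz (or_intror H')) as [-> ->].
    destruct (in_tree z' n); auto; cbn [andb].
    destruct (Nat.ltb_spec (rank z' n) M); auto; now rewrite Hz.
  - destruct (Nat.ltb_spec (rank z n) M), (Nat.ltb_spec (rank z' n) M); try lia.
    now rewrite !Bool.andb_false_r.
Qed.

(** Label [M] describes the unique tree node of rank [M]. If that node is below [N], its factor 1 is
    replaced by three overlaps of sum 3; if not, the new label leaves the product unchanged. *)
Lemma density_fun_snoc_r f N z M :
  (forall p, f p < 2) ->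
  bsum 3 (fun d => density_fun f N (fun i => if i =? M then d else z i) (S M))
  = 3 * density_fun f N z M.
Proof.
  intros Hf; set (zd := fun d i => if i =? M then d else z i).
  assert (Hz : forall d i, i < M -> zd d i = z i).
  { intros d i Hi; unfold zd; destruct (Nat.eqb_spec i M); auto; lia. }
  assert (Hag : forall d n, rank z n <= M \/ rank (zd d) n <= M ->
            in_tree (zd d) n = in_tree z n /\ rank (zd d) n = rank z n).
  { intros d n H; apply (tree_agree _ _ M); auto; tauto. }
  assert (Hsame : forall d n, in_tree z n && (rank z n =? M) = false ->
    (if in_tree (zd d) n && (rank (zd d) n <? S M)
     then third_overlap (col_num f n N) (2 ^ col_len n N) (zd d (rank (zd d) n)) else 1)
    = (if in_tree z n && (rank z n <? M)
       then third_overlap (col_num f n N) (2 ^ col_len n N) (z (rank z n)) else 1)).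
  { intros d n H.
    destruct (Nat.leb_spec (rank z n) M) as [Hr|Hr];
      [|destruct (Nat.leb_spec (rank (zd d) n) M) as [Hr'|Hr']].
    - destruct (Hag d n (or_introl Hr)) as [-> ->].
      destruct (in_tree z n); auto; cbn [andb] in *; apply Nat.eqb_neq in H.
      destruct (Nat.ltb_spec (rank z n) (S M)), (Nat.ltb_spec (rank z n) M); try lia.
      now rewrite Hz.
    - destruct (Hag d n (or_intror Hr')) as [_ E]; lia.
    - destruct (Nat.ltb_spec (rank z n) M), (Nat.ltb_spec (rank (zd d) n) (S M)); try lia.
      now rewrite !Bool.andb_false_r. }
  destruct (classic (exists n0, n0 < N /\ in_tree z n0 && (rank z n0 =? M) = true))
    as [(n0 & Hn0 & E0)|Hno].
  - apply Bool.andb_true_iff in E0 as [E1 E2]; apply Nat.eqb_eq in E2.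
    apply (bprod_bsum_one 3 N n0 3 (fun d n => if in_tree (zd d) n && (rank (zd d) n <? S M)
      then third_overlap (col_num f n N) (2 ^ col_len n N) (zd d (rank (zd d) n)) else 1)); auto.
    + intros d n _ _ Hne; apply Hsame.
      destruct (in_tree z n) eqn:E; auto; cbn [andb]; apply Nat.eqb_neq; intros Er.
      destruct (Nat.lt_total n n0) as [H|[H|H]]; auto.
      * pose proof (rank_lt z _ _ H E); lia.
      * pose proof (rank_lt z _ _ H E1); lia.
    + rewrite E1, E2, Nat.ltb_irrefl; cbn [andb]; rewrite Nat.mul_1_r.
      rewrite (bsum_ext 3 _ (third_overlap (col_num f n0 N) (2 ^ col_len n0 N))).
      * apply third_overlap_labels, col_num_lt, Hf.
      * intros d _; destruct (Hag d n0) as [-> ->]; [lia|]; rewrite E1, E2; cbn [andb].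
        rewrite (proj2 (Nat.ltb_lt _ _)) by lia; unfold zd; now rewrite Nat.eqb_refl.
  - rewrite (bsum_ext 3 _ (fun _ => density_fun f N z M)), bsum_const; auto.
    intros d _; apply bprod_ext; intros n Hn; apply Hsame.
    destruct (in_tree z n && (rank z n =? M)) eqn:E; auto; exfalso; eauto.
Qed.

(** Position [N] holds a digit of a single column, whose interval is halved. *)
Lemma density_fun_snoc_l f N z M :
  bsum 2 (fun d => density_fun (fun p => if p =? N then d else f p) (S N) z M)
  = 2 * density_fun f N z M.
Proof.
  set (fd := fun d p => if p =? N then d else f p).
  assert (Hfd : forall d n, col_num (fd d) n N = col_num f n N).
  { intros d n; apply col_num_ext; intros p Hp; unfold fd.
    destruct (Nat.eqb_spec p N); auto; lia. }
  (* Both products get the same range: node [N] may be added because no digit of its column lies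
     before position [N]. *)
  assert (Hext : density_fun f N z M = bprod (S N) (fun n =>
    if in_tree z n && (rank z n <? M)
    then third_overlap (col_num f n N) (2 ^ col_len n N) (z (rank z n)) else 1)).
  { cbn [bprod]; rewrite col_num_small, col_len_small, Nat.pow_0_r, third_overlap_root by lia.
    destruct (_ && _); now rewrite Nat.mul_1_r. }
  rewrite Hext; destruct (classic (exists n0, N = pairing n0 (col_len n0 N))) as [[n0 E]|Hno].
  - apply (bprod_bsum_one 2 (S N) n0 2 (fun d n => if in_tree z n && (rank z n <? M)
      then third_overlap (col_num (fd d) n (S N)) (2 ^ col_len n (S N)) (z (rank z n)) else 1)).
    + pose proof (pairing_ge n0 (col_len n0 N)); lia.
    + intros d n _ _ Hne; cbn [col_num col_len]; rewrite Hfd.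
      destruct (Nat.eqb_spec N (pairing n (col_len n N))) as [E'|]; auto.
      exfalso; apply Hne, (pairing_inj n (col_len n N) n0 (col_len n0 N)); congruence.
    + cbn [col_num col_len]; rewrite <- E, Nat.eqb_refl, Nat.pow_succ_r'.
      destruct (_ && _); [|reflexivity]; rewrite <- third_overlap_split.
      apply bsum_ext; intros d _; rewrite Hfd; unfold fd; now rewrite Nat.eqb_refl.
  - rewrite <- Hext, (bsum_ext 2 _ (fun _ => density_fun f N z M)), bsum_const; auto.
    intros d _; rewrite Hext; apply bprod_ext; intros n _; cbn [col_num col_len].
    change (fun p => if p =? N then d else f p) with (fd d); rewrite Hfd.
    destruct (Nat.eqb_spec N (pairing n (col_len n N))) as [E'|]; auto; exfalso; eauto.
Qed.

Lemma nth_snoc_if (s : list nat) d p :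
  p <= length s -> nth p (s ++ [d]) 0 = if p =? length s then d else nth p s 0.
Proof.
  intros H; destruct (Nat.eqb_spec p (length s)) as [->|E]; [apply nth_middle|].
  apply app_nth1; lia.
Qed.

Lemma coupling_density : coupling 2 3 density.
Proof.
  split.
  - reflexivity.
  - intros s _; unfold density, density_fun; cbn [length].
    rewrite (bprod_ext _ _ (fun _ => 1)).
    + induction (length s) as [|n IH]; simpl; auto; lia.
    + intros i _; now rewrite Bool.andb_false_r.
  - intros s w _ _; unfold density at 2; rewrite <- density_fun_snoc_l.
    apply bsum_ext; intros d _; unfold density; rewrite length_app, Nat.add_1_r.
    apply density_fun_ext; auto; intros p Hp; apply nth_snoc_if; lia.
  - intros s w Hs _; unfold density at 2; rewrite <- density_fun_snoc_r.
    + apply bsum_ext; intros d _; unfold density; rewrite length_app, Nat.add_1_r.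
      apply density_fun_ext; auto; intros p Hp; apply nth_snoc_if; lia.
    + intros p; destruct (nth_in_or_default p s 0) as [H|H]; [|lia].
      now apply (proj1 (List.Forall_forall _ _) Hs).
Qed.

Lemma PR_node_in k c B n : PR k c -> PR k B -> PR k n ->
  PRb k (fun l => node_in (fun i => nth i (decode_str 3 (c l)) 0) (B l) (n l)).
Proof.
  apply (PR_comp3 k (fun c B n => Nat.b2n (node_in (fun i => nth i (decode_str 3 c) 0) B n))).
  unfold node_in, allowed, mask_rank, mask_bit; pr.
Qed.

Lemma PR_mask k c n : PR k c -> PR k n ->
  PR k (fun l => mask (fun i => nth i (decode_str 3 (c l)) 0) (n l)).
Proof.
  apply (PR_comp2 k (fun c n => mask (fun i => nth i (decode_str 3 c) 0) n)).
  apply (PR_rec 2 (fun l n => mask (fun i => nth i (decode_str 3 (hd 0 l)) 0) n) (fun _ => 0)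
    (fun m r l => r + if node_in (fun i => nth i (decode_str 3 (hd 0 l)) 0) r m then 2 ^ m else 0)
    (fun l => hd 0 (tl l))); auto; [pr|pr|pr_var].
  apply PR_node_in; pr.
Qed.

Lemma PR_density : PR 2 (fun l => density (decode_str 2 (hd 0 l)) (decode_str 3 (hd 0 (tl l)))).
Proof.
  unfold density, density_fun, in_tree, rank, mask_rank, mask_bit, third_overlap, label_third; pr;
    try apply PR_col_num; try apply PR_col_len; try apply PR_mask; try apply PR_node_in;
    try apply PR_mask; pr.
Qed.

(** * Trees and measures *)

Lemma sigma_str_S m : sigma_str (S m) = sigma_str (m / 2) ++ [Nat.odd m].
Proof.
  assert (H : forall f g n, n <= f -> n <= g -> sigma_fuel f n = sigma_fuel g n).
  { induction f as [|f IH]; intros [|g] [|n] Hf Hg; auto; try lia.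
    cbn [sigma_fuel]; pose proof (half_le n); f_equal; apply IH; lia. }
  unfold sigma_str at 1; cbn [sigma_fuel]; f_equal; apply H; auto; apply half_le.
Qed.

Lemma double_bit_half i b : (2 * i + Nat.b2n b) / 2 = i.
Proof. rewrite Nat.add_comm, Nat.mul_comm, Nat.div_add by lia; now destruct b. Qed.

Lemma double_bit_odd i b : Nat.odd (2 * i + Nat.b2n b) = b.
Proof. rewrite Nat.odd_add, Nat.odd_mul; now destruct b. Qed.

(** The inverse of [sigma_str]: the root is 0 and the children of i are 2i+1 and 2i+2. *)
Definition string_index (s : list bool) : nat :=
  fold_left (fun n b => S (2 * n + Nat.b2n b)) s 0.

Lemma string_index_snoc s b : string_index (s ++ [b]) = S (2 * string_index s + Nat.b2n b).
Proof. unfold string_index; now rewrite fold_left_app. Qed.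

Lemma sigma_string_index s : sigma_str (string_index s) = s.
Proof.
  induction s as [|b s IH] using rev_ind; [reflexivity|].
  now rewrite string_index_snoc, sigma_str_S, double_bit_half, double_bit_odd, IH.
Qed.

Lemma string_index_sigma n : string_index (sigma_str n) = n.
Proof.
  induction n as [[|m] IH] using lt_wf_ind; [reflexivity|].
  pose proof (half_le m); rewrite sigma_str_S, string_index_snoc, IH by lia.
  now rewrite <- Nat.div2_div, <- Nat.div2_odd.
Qed.

Lemma string_index_level s :
  2 ^ length s <= S (string_index s) < 2 ^ S (length s).
Proof.
  induction s as [|b s IH] using rev_ind; [cbn; lia|].
  rewrite string_index_snoc, length_app, Nat.add_1_r, !Nat.pow_succ_r' in *.
  destruct b; simpl Nat.b2n; lia.
Qed.

Lemma length_filter_in_tree z a n :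
  rank z a + length (filter (in_tree z) (seq a n)) = rank z (a + n).
Proof.
  revert a; induction n as [|n IH]; intros a; simpl; [now rewrite !Nat.add_0_r|].
  rewrite <- Nat.add_succ_comm, <- IH, rank_S; destruct (in_tree z a); simpl; lia.
Qed.

(** Consecutive nodes have consecutive children, and the label index of [kids] advances exactly at
    tree nodes, as [rank] does. This identifies the tree built by levels with [in_tree]. *)
Lemma kids_in_tree z a n :
  kids z (rank z a) (map sigma_str (filter (in_tree z) (seq a n)))
  = map sigma_str (filter (in_tree z) (seq (S (2 * a)) (2 * n))).
Proof.
  revert a; induction n as [|n IH]; intros a; [reflexivity|].
  replace (2 * S n) with (S (S (2 * n))) by lia; cbn [seq].
  replace (S (S (S (2 * a)))) with (S (2 * S a)) by lia.
  pose proof (double_bit_half a false) as Hf; pose proof (double_bit_half a true) as Ht.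
  pose proof (double_bit_odd a false) as Of; pose proof (double_bit_odd a true) as Ot.
  simpl Nat.b2n in *; rewrite Nat.add_0_r, Nat.add_1_r in *.
  assert (Ef : in_tree z (S (2 * a)) = in_tree z a && allowed (z (rank z a)) false)
    by now rewrite in_tree_S, Hf, Of.
  assert (Et : in_tree z (S (S (2 * a))) = in_tree z a && allowed (z (rank z a)) true)
    by now rewrite in_tree_S, Ht, Ot.
  assert (Sf : sigma_str (S (2 * a)) = sigma_str a ++ [false]) by now rewrite sigma_str_S, Hf, Of.
  assert (St : sigma_str (S (S (2 * a))) = sigma_str a ++ [true]) by now rewrite sigma_str_S, Ht, Ot.
  cbn [filter]; rewrite Ef, Et; specialize (IH (S a)); rewrite rank_S in IH.
  destruct (in_tree z a); cbn [andb Nat.b2n map kids] in *.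
  - rewrite Nat.add_1_r in IH; rewrite IH.
    destruct (z (rank z a)) as [|[|d]]; cbn [allowed negb Nat.eqb map children app];
      now rewrite ?Sf, ?St.
  - now rewrite Nat.add_0_r in IH.
Qed.

Lemma T_level_in_tree z L :
  T_level z L = (rank z (2 ^ L - 1), map sigma_str (filter (in_tree z) (seq (2 ^ L - 1) (2 ^ L)))).
Proof.
  induction L as [|L IH]; [reflexivity|]; cbn [T_level]; rewrite IH.
  pose proof (Nat.pow_nonzero 2 L); rewrite Nat.pow_succ_r'.
  rewrite length_map, length_filter_in_tree, kids_in_tree; do 2 f_equal; [|do 2 f_equal]; lia.
Qed.

Lemma T3_in_tree z s : T3 z s <-> in_tree z (string_index s) = true.
Proof.
  unfold T3; rewrite T_level_in_tree; cbn [snd]; rewrite in_map_iff; split.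
  - intros (n & <- & Hn); rewrite string_index_sigma; now apply filter_In in Hn.
  - intros H; exists (string_index s); rewrite sigma_string_index; split; auto.
    apply filter_In; split; auto; apply in_seq.
    pose proof (string_index_level s); rewrite Nat.pow_succ_r' in *; lia.
Qed.

Lemma in_tree_snoc z s b :
  in_tree z (string_index (s ++ [b]))
  = in_tree z (string_index s) && allowed (z (rank z (string_index s))) b.
Proof. now rewrite string_index_snoc, in_tree_S, double_bit_half, double_bit_odd. Qed.

(** * From compatibility to equality of the trees *)

Lemma bprod_pos_term n f i : i < n -> 0 < bprod n f -> 0 < f i.
Proof.
  induction n as [|n IH]; intros Hi H; cbn [bprod] in *; [lia|].
  destruct (Nat.eq_dec i n) as [->|E]; [nia|apply IH; [lia|nia]].
Qed.

Lemma le_of_scaled (u v c : R) :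
  (forall k : nat, exists A : R, INR k <= A /\ u * A <= v * A + c)%R -> (u <= v)%R.
Proof.
  intros H; apply Rnot_lt_le; intros Hlt.
  destruct (INR_unbounded ((Rabs c + 1) / (u - v))) as [k Hk].
  destruct (H k) as (A & HA & HI).
  assert (HB : (Rabs c + 1 <= A * (u - v))%R) by (apply Rle_div_l; lra).
  pose proof (Rle_abs c); lra.
Qed.

Lemma INR_le_pow2 l : (INR l <= 2 ^ l)%R.
Proof.
  replace (2 ^ l)%R with (INR (2 ^ l)) by (rewrite pow_INR; reflexivity).
  apply le_INR, Nat.lt_le_incl, Nat.pow_gt_lin_r; lia.
Qed.

Definition compatible (x : nat -> bool) (z : nat -> nat) : Prop :=
  forall N M, 0 < density (prefix (bits x) N) (prefix z M).

(** The digit intervals shrink to the column while all of them meet the third of the label, so the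
    column lies in the closed third. The endpoints cannot be excluded at this point. *)
Lemma compatible_column x z n :
  compatible x z -> in_tree z n = true ->
  (INR (label_third (z (rank z n))) <= 3 * column_real x n
   <= INR (label_third (z (rank z n))) + 1)%R.
Proof.
  intros Hc Hn; set (a := label_third (z (rank z n))).
  assert (H : forall k, exists A, (INR k <= A /\
    INR a * A <= 3 * column_real x n * A + 3 /\ 3 * column_real x n * A <= (INR a + 1) * A + 3)%R).
  (* This [N] includes the factor of node [n] and more than k digits of its column; the second bound
     includes its label. *)
  { intros k; set (N := S (n + pairing n k)); specialize (Hc N (S (rank z n))).
    exists (2 ^ col_len n N)%R.
    assert (Hk : k < col_len n N) by (apply col_len_spec; unfold N; lia).
    split; [apply Rle_trans with (INR (col_len n N)); [apply le_INR; lia|apply INR_le_pow2]|].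
    unfold density in Hc; rewrite !length_prefix in Hc.
    rewrite (density_fun_ext _ (bits x) _ _ z) in Hc by (intros; now apply nth_prefix).
    apply (bprod_pos_term _ _ n) in Hc; [|unfold N; lia].
    cbv beta in Hc; rewrite Hn, (proj2 (Nat.ltb_lt _ _)) in Hc by lia; cbn [andb] in Hc.
    unfold third_overlap in Hc; fold a in Hc.
    pose proof (column_real_bounds x n N) as Hb; set (u := col_num (bits x) n N) in *.
    assert (H1 : a * 2 ^ col_len n N <= 3 * u + 3) by lia.
    assert (H2 : 3 * u <= (a + 1) * 2 ^ col_len n N) by lia.
    apply le_INR in H1; apply le_INR in H2.
    rewrite plus_INR, !mult_INR, pow_INR in H1; rewrite !mult_INR, pow_INR, plus_INR in H2.
    change (INR 2) with 2%R in *; simpl (INR 3) in *; simpl (INR 1) in *; lra. }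
  split; apply le_of_scaled with 3%R; intros k; destruct (H k) as (A & H1 & H2 & H3);
    exists A; split; auto.
Qed.

Lemma T_mu_snoc mu s b :
  T_mu mu (s ++ [b]) <-> T_mu mu s /\ (cond_prob mu (s ++ [b]) s > 1 / 3)%R.
Proof.
  assert (Hpre : forall n, n <= length s -> firstn n (s ++ [b]) = firstn n s).
  { intros n Hn; rewrite firstn_app; replace (n - length s) with 0 by lia; apply app_nil_r. }
  assert (Hlast : firstn (S (length s)) (s ++ [b]) = s ++ [b])
    by (apply firstn_all2; rewrite length_app, Nat.add_1_r; auto).
  unfold T_mu; rewrite length_app, Nat.add_1_r; split.
  - intros H; split.
    + intros i Hi; specialize (H i); rewrite !Hpre in H by lia; apply H; lia.
    + specialize (H (length s) (Nat.lt_succ_diag_r _)).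
      now rewrite Hlast, Hpre, firstn_all in H.
  - intros [H1 H2] i Hi; destruct (Nat.eq_dec i (length s)) as [->|E].
    + now rewrite Hlast, Hpre, firstn_all.
    + rewrite !Hpre by lia; apply H1; lia.
Qed.

(** A null string has quotient 0 whatever the mass of its parent, so along [T_mu] the division in
    [cond_prob] is genuine. *)
Lemma T_mu_pos mu s : cyl_prob mu -> T_mu mu s -> (0 < mu s)%R.
Proof.
  intros [H1 H2]; destruct s as [|b s _] using rev_ind; [rewrite H1; lra|].
  rewrite T_mu_snoc; unfold cond_prob; intros [_ H].
  destruct (proj1 (H2 (s ++ [b]))) as [|E]; auto.
  rewrite <- E in H; unfold Rdiv in H; rewrite Rmult_0_l in H; lra.
Qed.

Lemma cond_prob_column x mu s b : is_mu_of x mu -> (0 < mu s)%R ->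
  cond_prob mu (s ++ [b]) s
  = (if b then 1 - column_real x (string_index s) else column_real x (string_index s))%R.
Proof.
  intros [[_ Hadd] Hmu] Hs; unfold cond_prob.
  specialize (Hmu (string_index s)); rewrite sigma_string_index in Hmu.
  pose proof (proj2 (Hadd s)) as E; rewrite Hmu in E; destruct b.
  - replace (mu (s ++ [true])) with ((1 - column_real x (string_index s)) * mu s)%R by lra.
    field; lra.
  - rewrite Hmu; field; lra.
Qed.

(** The left child survives if the column is above 1/3, the right one if it is below 2/3. For labels
    0 and 1 the closed third decides both questions; label 2 needs both strict inequalities, which
    [column_not_third] provides. *)
Lemma T_mu_in_tree x z mu s :
  ML_random 2 (bits x) -> (forall i, z i < 3) -> compatible x z -> is_mu_of x mu ->
  T_mu mu s <-> in_tree z (string_index s) = true.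
Proof.
  intros Hx Hz Hc Hmu; induction s as [|b s IH] using rev_ind.
  - split; [reflexivity|intros _ i Hi; simpl in Hi; lia].
  - rewrite T_mu_snoc, in_tree_snoc, IH, Bool.andb_true_iff.
    split; (intros [Hs Hb]; split; [exact Hs|]);
      pose proof (T_mu_pos mu s (proj1 Hmu) (proj2 IH Hs)) as Hpos;
      pose proof (compatible_column x z (string_index s) Hc Hs) as Hcol;
      pose proof (column_not_third 1 x (string_index s) (or_introl eq_refl) Hx) as N1;
      pose proof (column_not_third 2 x (string_index s) (or_intror eq_refl) Hx) as N2;
      rewrite (cond_prob_column x mu s b Hmu Hpos) in *;
      specialize (Hz (rank z (string_index s)));
      destruct (z (rank z (string_index s))) as [|[|[|d]]]; try lia;
      [change (label_third 0) with 2 in Hcol|change (label_third 1) with 0 in Hcol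
      |change (label_third 2) with 1 in Hcol
      |change (label_third 0) with 2 in Hcol|change (label_third 1) with 0 in Hcol
      |change (label_third 2) with 1 in Hcol];
      simpl (INR _) in *; destruct b; cbn in *; try discriminate; auto; lra.
Qed.

Lemma third_support_paths x z mu :
  ML_random 2 (bits x) -> (forall i, z i < 3) -> compatible x z -> is_mu_of x mu ->
  forall y, third_support mu y <-> paths_T3 z y.
Proof.
  intros Hx Hz Hc Hmu y; unfold third_support, paths_T3; split; intros H N;
    specialize (H N); [apply T3_in_tree, (T_mu_in_tree x z mu)|
                       apply (T_mu_in_tree x z mu), T3_in_tree]; auto.
Qed.

(** Cylinders are refined at the end of a string, so the recursion runs over its reverse. *)
Fixpoint reversed_measure (x : nat -> bool) (r : list bool) : R :=
  match r with
  | [] => 1%R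
  | b :: r' =>
      let c := column_real x (string_index (rev r')) in
      ((if b then 1 - c else c) * reversed_measure x r')%R
  end.

Lemma is_mu_of_exists x : exists mu, is_mu_of x mu.
Proof.
  exists (fun s => reversed_measure x (rev s)); split; [split; [reflexivity|]|].
  - intros s; split.
    + induction (rev s) as [|b r IH]; simpl; [lra|].
      pose proof (column_real_unit x (string_index (rev r))).
      apply Rmult_le_pos; auto; destruct b; lra.
    + rewrite !rev_app_distr; simpl; ring.
  - intros n; rewrite rev_app_distr; simpl.
    now rewrite rev_involutive, string_index_sigma.
Qed.

Theorem theorem5p3 (C : (nat -> bool) -> Prop) :
  cantor_closed C -> (exists y, C y) ->
  (random_closed_set C <->
   exists mu : list bool -> R,
     random_measure mu /\ forall y, C y <-> third_support mu y).
Proof.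
  intros _ _; split.
  - intros (z & Hz & HC).
    destruct (coupling_random 2 3 density z) as (y & Hy & Hpos);
      auto using coupling_density, PR_density.
    set (x := fun i => y i =? 1).
    assert (Hx : bits x = y).
    { apply functional_extensionality; intros i; unfold bits, x.
      pose proof (proj1 Hy i); destruct (Nat.eqb_spec (y i) 1); lia. }
    rewrite <- Hx in Hy; assert (Hc : compatible x z) by (unfold compatible; now rewrite Hx).
    destruct (is_mu_of_exists x) as [mu Hmu]; exists mu; split; [now exists x|].
    intros y'; rewrite HC; symmetry; apply (third_support_paths x z mu); auto; apply Hz.
  - intros (mu & (x & Hx & Hmu) & HC).
    destruct (coupling_random 3 2 (fun s w => density w s) (bits x)) as (z & Hz & Hpos); auto.
    + apply coupling_sym, coupling_density.
    + apply (PR_comp2 2 (fun c k => density (decode_str 2 c) (decode_str 3 k)));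
        [apply PR_density|pr|pr].
    + exists z; split; auto; intros y; rewrite HC.
      apply (third_support_paths x z mu); auto; [apply Hz|intros N M; apply Hpos].
Qed.
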